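(* Any minimal mutation-infinite quiver contains at most $10$ vertices.
   Context: A quiver is a finite directed multigraph without loops and oriented $2$-cycles; parallel arrows are recorded as one edge with a positive integer weight. A quiver with vertices $1,\dots,n$ is the same as a skew-symmetric integer $n\times n$ matrix $B$: if $B_{ij}>0$ there is an edge $i\to j$ of weight $B_{ij}$. The mutation in direction $k$ sends $B$ to $B'$ with $B'_{ij}=-B_{ij}$ if $i=k$ or $j=k$, and $B'_{ij}=B_{ij}+\frac{|B_{ik}|B_{kj}+B_{ik}|B_{kj}|}{2}$ otherwise. The mutation class of a quiver is the set of all quivers obtained from it by finite sequences of mutations; a quiver is mutation-finite if this class is finite and mutation-infinite otherwise. Subquivers are full: a subquiver is determined by a subset of vertices and contains all edges (with weights) between them, i.e. it corresponds to a principal submatrix. A minimal mutation-infinite quiver is a mutation-infinite quiver all of whose proper subquivers are mutation-finite. *)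

(* Defs.v *)
From mathcomp Require Import all_boot all_order all_algebra.

Set Implicit Arguments.
Unset Strict Implicit.
Unset Printing Implicit Defensive.

Import Order.TTheory GRing.Theory Num.Theory.

Local Open Scope ring_scope.

(* B i j > 0 encodes an arrow i -> j of weight B i j.  Over int, skew-symmetry
   forces a zero diagonal, so there are no loops. *)
Definition is_quiver n (B : 'M[int]_n) : Prop := B^T = - B.

(* The numerator is always even, so the integer division by 2 is exact. *)
Definition mutation n (B : 'M[int]_n) (k : 'I_n) : 'M[int]_n :=
  \matrix_(i, j)
    if (i == k) || (j == k) then - B i j
    else B i j + ((`|B i k| * B k j + B i k * `|B k j|) %/ 2)%Z.

Definition in_mutation_class n (B C : 'M[int]_n) : Prop :=
  exists ks : seq 'I_n, C = foldl (@mutation n) B ks.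

Definition mutation_finite n (B : 'M[int]_n) : Prop :=
  exists cls : seq 'M[int]_n, forall C, in_mutation_class B C -> C \in cls.

Definition mutation_infinite n (B : 'M[int]_n) : Prop := ~ mutation_finite B.

(* The vertices of S are relabelled increasingly by 'I_#|S|. *)
Definition subquiver n (B : 'M[int]_n) (S : {set 'I_n}) : 'M[int]_#|S| :=
  mxsub enum_val enum_val B.

Definition minimal_mutation_infinite n (B : 'M[int]_n) : Prop :=
  mutation_infinite B /\
  forall S : {set 'I_n}, S \proper [set: 'I_n] ->
    mutation_finite (subquiver B S).

(* Main.v *)
From Stdlib Require Import ZArith Lia.
Require Import Defs.
From mathcomp Require Import all_boot all_order all_algebra.
From mathcomp Require Import zify ssrZ.

Set Implicit Arguments.
Unset Strict Implicit.
Unset Printing Implicit Defensive.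

(* Forbid the mutation-infinite quivers on three vertices, those in the lists [mmi4],
   [mmi5], [mmi6] below, and the mutation classes of E6 and X6.  A quiver without
   forbidden subquivers ("tame") stays tame under mutation: a new forbidden
   subquiver has at most 6 vertices and appears within itself and the mutated vertex, so
   this is a finite check.  Triples of tame quivers are mutation-finite, so their weights
   stay bounded, and tame quivers are mutation-finite.

   A minimal mutation-infinite quiver with at least 11 vertices is connected, and its
   subquivers with at most 10 vertices are mutation-finite.  So the only forbidden
   subquivers it may contain are those of type E6 and X6.  These are excluded by mutating
   inside the subquiver only, which keeps the larger subquivers on at most 10
   vertices mutation-finite.  A vertex attached to E6 either turns it into E7 up to mutation,
   or is attached in one of a few remaining ways, which turn out to be incompatible
   for three vertices; then E7 yields E8 in the same way, and to E8 (and to X6) one cannot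
   attach three vertices in a connected way such that each pair is mutation-finite. *)

(* Quivers as lists of integer rows *)
Delimit Scope Z_scope with Zd.

(* The quiver on an enumerated vertex set, newest vertex first: row [i] lists the
   entries [b i j] for the later positions [j > i] only. *)
Definition code := seq (seq Z).

Definition triangle : nat -> seq Z -> code :=
  fix go n l := if n is n'.+1 then take n' l :: go n' (drop n' l) else [::].

(* [step (b i j) (Some (b i k)) (Some (b j k))] is the mutated entry; the second
   factor is [b j k = - b k j], hence the opposite signs.  [None] marks the
   mutated vertex. *)
Definition step (x : Z) (a b : option Z) : Z :=
  match a, b with
  | Some (Zpos p), Some (Zneg q) => Z.add x (Zpos (Pos.mul p q))
  | Some (Zneg p), Some (Zpos q) => Z.sub x (Zpos (Pos.mul p q))
  | Some _, Some _ => x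
  | _, _ => Z.opp x
  end.

Fixpoint column (c : code) (k : nat) : seq (option Z) :=
  match c, k with
  | r :: _, 0 => None :: map (fun x => Some (Z.opp x)) r
  | r :: c', k'.+1 => Some (nth 0%Zd r k') :: column c' k'
  | [::], _ => [::]
  end.

Fixpoint mutrow (a : option Z) (r : seq Z) (kv : seq (option Z)) : seq Z :=
  match r, kv with
  | x :: r', b :: kv' => step x a b :: mutrow a r' kv'
  | _, _ => [::]
  end.

Fixpoint mutrows (c : code) (kv : seq (option Z)) : code :=
  match c, kv with
  | r :: c', a :: kv' => mutrow a r kv' :: mutrows c' kv'
  | _, _ => [::]
  end.

Definition cmut (c : code) (k : nat) : code := mutrows c (column c k).
Definition cmuts (c : code) (ks : seq nat) : code := foldl cmut c ks.

Fixpoint fullcols (r : seq Z) (m : code) : code :=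
  match r, m with
  | x :: r', row :: m' => (Z.opp x :: row) :: fullcols r' m'
  | _, _ => [::]
  end.
Fixpoint full (c : code) : code :=
  if c is r :: c' then (0%Zd :: r) :: fullcols r (full c') else [::].

Definition full_entry (m : code) (i j : nat) : Z := nth 0%Zd (nth [::] m i) j.

(** The positions in [l] may come in any order, so this restricts to a subquiver and renumbers its
    vertices at once. *)
Fixpoint full_sub (m : code) (l : seq nat) : code :=
  if l is x :: l' then
    (let row := nth [::] m x in map (nth 0%Zd row) l') :: full_sub m l'
  else [::].
Definition csub c l := full_sub (full c) l.

(* The mutation-finite quivers on three vertices [i], [j], [k], in terms of
   [x = b i j], [y = b j k], [z = b i k]. *)
Definition ok3 (x y z : Z) : bool :=
  match x, y, z with
  | Zpos 1, Zpos 1, Zneg 2 | Zpos 1, Zpos 2, Zneg 1 | Zpos 2, Zpos 1, Zneg 1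
  | Zpos 2, Zpos 2, Zneg 2
  | Zneg 1, Zneg 1, Zpos 2 | Zneg 1, Zneg 2, Zpos 1 | Zneg 2, Zneg 1, Zpos 1
  | Zneg 2, Zneg 2, Zpos 2 => true
  | (Zpos 1 | Zneg 1), (Zpos 1 | Zneg 1), (Zpos 1 | Zneg 1) => true
  | Z0, (Zpos 1 | Zneg 1), (Zpos 1 | Zneg 1) => true
  | (Zpos 1 | Zneg 1), Z0, (Zpos 1 | Zneg 1) => true
  | (Zpos 1 | Zneg 1), (Zpos 1 | Zneg 1), Z0 => true
  | Z0, Z0, _ | Z0, _, Z0 | _, Z0, Z0 => true
  | _, _, _ => false
  end.

(** Conditionals instead of [&&] make the test stop at the first bad triple under call-by-value
    evaluation. *)
Fixpoint ok3x (x : Z) (r2 r : seq Z) : bool :=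
  match r2, r with
  | y :: r2', z :: r' => if ok3 x y z then ok3x x r2' r' else false
  | _, _ => true
  end.
Fixpoint ok3new (r : seq Z) (c : code) : bool :=
  match r, c with
  | x :: r', r2 :: c' => if ok3x x r2 r' then ok3new r' c' else false
  | _, _ => true
  end.
Fixpoint ok3all (c : code) : bool :=
  if c is r :: c' then (if ok3new r c' then ok3all c' else false) else true.

(* Out-of-range directions are skipped, so one walk serves quivers of all sizes. *)
Fixpoint walk (c : code) (ks : seq nat) : bool :=
  if ok3all c then
    (if ks is k :: ks' then (if (k < size c)%N then walk (cmut c k) ks' else walk c ks') else false)
  else true.

Definition weights : seq Z := [:: -2; -1; 0; 1; 2]%Zd.

(* All rows of weights attaching a new vertex, pruned as soon as the new vertex
   together with a final segment of the old ones is [bad]. *)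
Fixpoint extensions (bad : code -> bool) (c : code) : seq (seq Z) :=
  if c is r :: c' then
    flatten (map (fun a =>
      flatten (map (fun w => let a' := w :: a in if bad (a' :: c) then [::] else [:: a']) weights))
     (extensions bad c'))
  else [:: [::]].

Fixpoint eqrow (r s : seq Z) : bool :=
  match r, s with
  | [::], [::] => true
  | x :: r', y :: s' => if Z.eqb x y then eqrow r' s' else false
  | _, _ => false
  end.
Fixpoint eqcode (c d : code) : bool :=
  match c, d with
  | [::], [::] => true
  | r :: c', s :: d' => if eqrow r s then eqcode c' d' else false
  | _, _ => false
  end.

Lemma eqrowP r s : reflect (r = s) (eqrow r s).
Proof.
elim: r s => [|x r IH] [|y s] /=; try by constructor.
case: Z.eqb_spec => [->|ne]; last by constructor; case.
by apply: (iffP (IH s)) => [->|[]].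
Qed.

Lemma eqcodeP c d : reflect (c = d) (eqcode c d).
Proof.
elim: c d => [|x r IH] [|y s] /=; try by constructor.
case: eqrowP => [->|ne]; last by constructor; case.
by apply: (iffP (IH s)) => [->|[]].
Qed.

(** * Mutation of skew-symmetric functions and of their codes *)

Section Functions.
Variable T : finType.
Implicit Types (b : T -> T -> Z) (t : seq T).

Definition skewsym b := forall i j, b j i = Z.opp (b i j).

Definition mutf b k i j : Z :=
  step (b i j) (if i == k then None else Some (b i k)) (if j == k then None else Some (b j k)).

Fixpoint code_of b t : code :=
  if t is x :: t' then map (b x) t' :: code_of b t' else [::].

Lemma skew_diag b i : skewsym b -> b i i = 0%Zd.
Proof. move=> /(_ i i); lia. Qed.

Lemma step_opp x a c : step (Z.opp x) c a = Z.opp (step x a c).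
Proof. by case: a => [[|p|p]|]; case: c => [[|q|q]|] //=; lia. Qed.

Lemma skew_mutf b k : skewsym b -> skewsym (mutf b k).
Proof. by move=> sb i j; rewrite /mutf (sb i j) step_opp. Qed.

Lemma mutf_involutive b k i j : skewsym b -> mutf (mutf b k) k i j = b i j.
Proof.
move=> sb; rewrite /mutf !eqxx.
have bk l : step (b l k) (if l == k then None else Some (b l k)) None = Z.opp (b l k).
  by case: (l == k) => //; case: (b l k).
rewrite !bk; case: (i == k) => /=; first by case: (j == k) => /=; rewrite ?Z.opp_involutive.
case: (j == k) => /=; first by case: (b i k) => *; rewrite /= ?Z.opp_involutive.
case: (b i k) => [|p|p]; case: (b j k) => [|q|q] //=; lia.
Qed.

Lemma eq_code_of b b' t : b =2 b' -> code_of b t = code_of b' t.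
Proof. by move=> e; elim: t => //= x t ->; congr cons; apply: eq_map. Qed.

Lemma size_code b t : size (code_of b t) = size t.
Proof. by elim: t => //= x t ->. Qed.

Lemma column_code b t k x0 : skewsym b -> uniq t -> (k < size t)%N ->
  column (code_of b t) k =
  [seq if i == nth x0 t k then None else Some (b i (nth x0 t k)) | i <- t].
Proof.
move=> sb; elim: t k => [|x t IH] [|k] //= /andP[xt ut] kt.
  rewrite eqxx -map_comp; congr cons; apply/eq_in_map => y yt /=.
  by rewrite (sb x y) ifN //; apply: contraNneq xt => <-.
rewrite (nth_map x0) // IH // ifN //.
by apply: contraNneq xt => ->; exact: mem_nth.
Qed.

Lemma cmut_code b t k x0 : skewsym b -> uniq t -> (k < size t)%N ->
  cmut (code_of b t) k = code_of (mutf b (nth x0 t k)) t.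
Proof.
move=> sb ut kt; rewrite /cmut (column_code x0 sb ut kt); move: (nth x0 t k) => v.
elim: t {ut kt} => //= x t ->; congr cons.
by elim: t => //= y t ->.
Qed.

Lemma full_code b t : skewsym b -> full (code_of b t) = [seq [seq b x y | y <- t] | x <- t].
Proof.
move=> sb; elim: t => //= x t ->; congr ((_ :: _) :: _).
  by rewrite skew_diag.
(* The induction runs over the rows only; the columns stay indexed by the whole of [t]. *)
have: {subset t <= t} by [].
elim: {1 3 5 7}t => //= y s IH st; congr ((_ :: _) :: _); first by rewrite -sb.
by apply: IH => z zs; apply: st; rewrite inE zs orbT.
Qed.

Lemma csub_code b t l x0 : skewsym b -> all (fun i => i < size t)%N l ->
  csub (code_of b t) l = code_of b (map (nth x0 t) l).
Proof.
move=> sb; rewrite /csub full_code //; elim: l => //= i l IH /andP[it lt].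
rewrite IH //; congr cons; rewrite (nth_map x0) // -map_comp.
by apply/eq_in_map => j /(allP lt) jt /=; rewrite (nth_map x0).
Qed.

End Functions.

(** * Quivers on three vertices *)

Lemma ok3_small x y z : ok3 x y z ->
  [\/ x = 0 /\ y = 0, x = 0 /\ z = 0, y = 0 /\ z = 0 |
      [/\ Z.abs x <= 2, Z.abs y <= 2 & Z.abs z <= 2]]%Zd.
Proof.
case: x => [|[p|[p|p|]|]|[p|[p|p|]|]]; case: y => [|[q|[q|q|]|]|[q|[q|q|]|]];
  case: z => [|[r|[r|r|]|]|[r|[r|r|]|]] //= _;
  by [apply: Or41|apply: Or42|apply: Or43|apply: Or44].
Qed.

Lemma ok3_swap12 x y z : ok3 x y z -> ok3 (Z.opp x) z y.
Proof.
by case: x => [|[p|[p|p|]|]|[p|[p|p|]|]]; case: y => [|[q|[q|q|]|]|[q|[q|q|]|]];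
  case: z => [|[r|[r|r|]|]|[r|[r|r|]|]].
Qed.

Lemma ok3_swap23 x y z : ok3 x y z -> ok3 z (Z.opp y) x.
Proof.
by case: x => [|[p|[p|p|]|]|[p|[p|p|]|]]; case: y => [|[q|[q|q|]|]|[q|[q|q|]|]];
  case: z => [|[r|[r|r|]|]|[r|[r|r|]|]].
Qed.

Lemma ok3_mut x y z : ok3 x y z ->
  ok3 (Z.opp x) (step y (Some (Z.opp x)) (Some (Z.opp z))) (Z.opp z).
Proof.
by case: x => [|[p|[p|p|]|]|[p|[p|p|]|]]; case: y => [|[q|[q|q|]|]|[q|[q|q|]|]];
  case: z => [|[r|[r|r|]|]|[r|[r|r|]|]].
Qed.

(** A derivation is a mutation sequence on a triple [i], [j], [k], with weights read as in [ok3],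
    that ends with a weight above [M]. The last three constructors mutate at [i], [j] and [k]. *)
Inductive escapes (M x y z : Z) : Prop :=
| Escape : (M < Z.abs x \/ M < Z.abs y \/ M < Z.abs z)%Zd -> escapes M x y z
| Escape1 : escapes M (Z.opp x) (step y (Some (Z.opp x)) (Some (Z.opp z))) (Z.opp z) ->
    escapes M x y z
| Escape2 : escapes M (Z.opp x) (Z.opp y) (step z (Some x) (Some (Z.opp y))) -> escapes M x y z
| Escape3 : escapes M (step x (Some z) (Some y)) (Z.opp y) (Z.opp z) -> escapes M x y z.

Ltac step_to v := rewrite (_ : step _ _ _ = v); last by cbv [step Z.opp]; lia.

(* Replacing the smallest weight [c] of a cyclic triangle by [ab - c] increases the sum. *)
Lemma escapes_grow M (n : nat) (a b c : positive) :
  (3 * M < Zpos a + Zpos b + Zpos c + Z.of_nat n)%Zd ->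
  ((2 <= Zpos a /\ 3 <= Zpos b) \/ (3 <= Zpos a /\ 2 <= Zpos b) \/
   (2 <= Zpos a /\ 3 <= Zpos c) \/ (3 <= Zpos a /\ 2 <= Zpos c) \/
   (2 <= Zpos b /\ 3 <= Zpos c) \/ (3 <= Zpos b /\ 2 <= Zpos c))%Zd ->
  escapes M (Zpos a) (Zpos b) (Zneg c) /\ escapes M (Zneg a) (Zneg b) (Zpos c).
Proof.
(* [n] bounds the number of further growth steps: at 0 the sum exceeds [3 * M], so one weight
   exceeds [M]. *)
elim: n a b c => [|n IH] a b c sum two.
  by split; apply: Escape; lia.
have [cmin|[amin|bmin]] : ((Zpos c <= Zpos a /\ Zpos c <= Zpos b) \/
   (Zpos a <= Zpos b /\ Zpos a <= Zpos c) \/ (Zpos b <= Zpos a /\ Zpos b <= Zpos c))%Zd by lia.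
(* The two larger weights are at least 2 and 3, so their product exceeds twice the smallest
   weight. *)
- have gt : (Zpos c + Zpos c < Zpos a * Zpos b)%Zd by nia.
  have [E1 E2] := IH a b (a * b - c)%positive ltac:(lia) ltac:(nia).
  split; apply: Escape2.
  + by step_to (Zpos (a * b - c)%positive).
  + by step_to (Zneg (a * b - c)%positive).
- have gt : (Zpos a + Zpos a < Zpos c * Zpos b)%Zd by nia.
  have [E1 E2] := IH (c * b - a)%positive b c ltac:(lia) ltac:(nia).
  split; apply: Escape3.
  + by step_to (Zneg (c * b - a)%positive).
  + by step_to (Zpos (c * b - a)%positive).
- have gt : (Zpos b + Zpos b < Zpos a * Zpos c)%Zd by nia.
  have [E1 E2] := IH a (a * c - b)%positive c ltac:(lia) ltac:(nia).
  split; apply: Escape1.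
  + by step_to (Zneg (a * c - b)%positive).
  + by step_to (Zpos (a * c - b)%positive).
Qed.

(** Triangles too small for [escapes_grow] reach its range in one mutation: weights 1, 1, c with c
    at least 3 become 1, c - 1, c, and weights 1, 2, 2 become 3, 2, 2. *)
Lemma escapes_cyclic M (a b c : positive) :
  ~~ ok3 (Zpos a) (Zpos b) (Zneg c) ->
  escapes M (Zpos a) (Zpos b) (Zneg c) /\ escapes M (Zneg a) (Zneg b) (Zpos c).
Proof.
move=> nok.
have G a' b' c' := @escapes_grow M (Z.to_nat (3 * M + 1)) a' b' c' ltac:(lia).
have [big|small] : (((2 <= Zpos a /\ 3 <= Zpos b) \/ (3 <= Zpos a /\ 2 <= Zpos b) \/
   (2 <= Zpos a /\ 3 <= Zpos c) \/ (3 <= Zpos a /\ 2 <= Zpos c) \/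
   (2 <= Zpos b /\ 3 <= Zpos c) \/ (3 <= Zpos b /\ 2 <= Zpos c)) \/
  ~ ((2 <= Zpos a /\ 3 <= Zpos b) \/ (3 <= Zpos a /\ 2 <= Zpos b) \/
   (2 <= Zpos a /\ 3 <= Zpos c) \/ (3 <= Zpos a /\ 2 <= Zpos c) \/
   (2 <= Zpos b /\ 3 <= Zpos c) \/ (3 <= Zpos b /\ 2 <= Zpos c)))%Zd by lia.
  exact: G.
have [[ea eb]|[[ea ec]|[[eb ec]|two]]] :
  ((a = 1 /\ b = 1) \/ (a = 1 /\ c = 1) \/ (b = 1 /\ c = 1) \/
   (a <= 2 /\ b <= 2 /\ c <= 2))%positive by lia.
- subst a b; have c3 : (3 <= Zpos c)%Zd by case: c nok small {G} => [p|[p|p|]|] //=; lia.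
  have [E1 E2] := G 1%positive (c - 1)%positive c ltac:(lia).
  split; apply: Escape1.
  + by step_to (Zneg (c - 1)%positive).
  + by step_to (Zpos (c - 1)%positive).
- subst a c; have b3 : (3 <= Zpos b)%Zd by case: b nok small {G} => [p|[p|p|]|] //=; lia.
  have [E1 E2] := G 1%positive b (b - 1)%positive ltac:(lia).
  split; apply: Escape2.
  + by step_to (Zpos (b - 1)%positive).
  + by step_to (Zneg (b - 1)%positive).
- subst b c; have a3 : (3 <= Zpos a)%Zd by case: a nok small {G} => [p|[p|p|]|] //=; lia.
  have [E1 E2] := G a (a - 1)%positive 1%positive ltac:(lia).
  split; apply: Escape1.
  + by step_to (Zneg (a - 1)%positive).
  + by step_to (Zpos (a - 1)%positive).
have {two} [ea [eb ec]] :
  ((a = 1 \/ a = 2) /\ (b = 1 \/ b = 2) /\ (c = 1 \/ c = 2))%positive by lia.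
case: ea => ?; case: eb => ?; case: ec => ?; subst a b c => //.
- have [E1 E2] := G 3%positive 2%positive 2%positive ltac:(lia).
  by split; apply: Escape3.
- have [E1 E2] := G 2%positive 3%positive 2%positive ltac:(lia).
  by split; apply: Escape1.
- have [E1 E2] := G 2%positive 2%positive 3%positive ltac:(lia).
  by split; apply: Escape2.
Qed.

Lemma step_opp_all x a c :
  step (Z.opp x) (Some (Z.opp a)) (Some (Z.opp c)) = Z.opp (step x (Some a) (Some c)).
Proof. by case: a => [|p|p]; case: c => [|q|q] //=; lia. Qed.

Lemma escapesN M x y z :
  escapes M x y z -> escapes M (Z.opp x) (Z.opp y) (Z.opp z).
Proof.
elim=> {x y z} x y z H; first by apply: Escape; rewrite !Z.abs_opp.
- by move=> IH; apply: Escape1; rewrite step_opp_all.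
- by move=> IH; apply: Escape2; rewrite step_opp_all.
- by move=> IH; apply: Escape3; rewrite step_opp_all.
Qed.

(** Mutation at the middle vertex gives a cyclic triangle with a weight [a * b + c]; if that one
    were finite, all three weights would be 1. *)
Lemma escapes_pos_acyclic M (a b c : positive) :
  ~~ ok3 (Zpos a) (Zpos b) (Zpos c) -> escapes M (Zpos a) (Zpos b) (Zpos c).
Proof.
move=> nok; apply: Escape2; step_to (Zpos (a * b + c)%positive).
apply: (proj2 (@escapes_cyclic M a b (a * b + c) _)).
apply: contra nok => /ok3_small[[]|[]|[]|[]] // _ _ h.
have {h} : (a * b + c <= 2)%positive by lia.
by move=> h; have [-> [-> ->]] : (a = 1 /\ b = 1 /\ c = 1)%positive by nia.
Qed.

Lemma escapes_path M (a b : positive) :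
  ~~ ok3 (Zpos a) (Zpos b) Z0 -> escapes M (Zpos a) (Zpos b) Z0.
Proof.
move=> nok; apply: Escape2; step_to (Zpos (a * b)%positive).
apply: (proj2 (@escapes_cyclic M a b (a * b) _)).
apply: contra nok.
by case: a => [p|[p|p|]|]; case: b => [q|[q|q|]|].
Qed.

Lemma escapes_rot M x y z : escapes M x y z -> escapes M y (Z.opp z) (Z.opp x).
Proof.
elim=> {x y z} x y z H; first by apply: Escape; rewrite !Z.abs_opp; lia.
- by rewrite !Z.opp_involutive => IH; apply: Escape3; rewrite !Z.opp_involutive.
- by rewrite !Z.opp_involutive -step_opp => IH; apply: Escape1; rewrite !Z.opp_involutive.
- by rewrite !Z.opp_involutive -step_opp => IH; apply: Escape2; rewrite !Z.opp_involutive.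
Qed.

Lemma escapes_rotV M x y z : escapes M y (Z.opp z) (Z.opp x) -> escapes M x y z.
Proof. by move=> /escapes_rot /escapes_rot; rewrite !Z.opp_involutive. Qed.

Lemma ok3_rot x y z : ok3 x y z -> ok3 y (Z.opp z) (Z.opp x).
Proof. by move=> /ok3_swap12 /ok3_swap23. Qed.

Lemma ok3_opp x y z : ok3 x y z -> ok3 (Z.opp x) (Z.opp y) (Z.opp z).
Proof.
by case: x => [|[p|[p|p|]|]|[p|[p|p|]|]]; case: y => [|[q|[q|q|]|]|[q|[q|q|]|]];
  case: z => [|[r|[r|r|]|]|[r|[r|r|]|]].
Qed.

(** If the middle vertex is a source or a sink, mutating at the first vertex reverses only one edge
    and leaves an oriented path. *)
Lemma escapes_two M x y : ~~ ok3 x y 0%Zd -> escapes M x y 0%Zd.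
Proof.
have ok30y v : ok3 0%Zd v 0%Zd by case: v => [|[p|[p|p|]|]|[p|[p|p|]|]].
have ok3x0 v : ok3 v 0%Zd 0%Zd by case: v => [|[p|[p|p|]|]|[p|[p|p|]|]].
case: x => [|a|a]; first by rewrite ok30y.
all: case: y => [|b|b]; first by rewrite ok3x0.
- exact: escapes_path.
- move=> nc; apply: (Escape1 (x := Zpos a)) => /=.
  rewrite (_ : Zneg a = Z.opp (Zpos a)) // (_ : Zneg b = Z.opp (Zpos b)) //.
  apply: (@escapesN M (Zpos a) (Zpos b) Z0); apply: escapes_path.
  by apply: contra nc; case: (a) => [[]|[]|]; case: (b) => [[]|[]|].
- move=> nc; apply: (Escape1 (x := Zneg a)) => /=.
  apply: escapes_path.
  by apply: contra nc; case: (a) => [[]|[]|]; case: (b) => [[]|[]|].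
- move=> nc; apply: (@escapesN M (Zpos a) (Zpos b) Z0); apply: escapes_path.
  by apply: contra nc; case: (a) => [[]|[]|]; case: (b) => [[]|[]|].
Qed.

(** Rotating the three vertices and reversing all arrows reduce every sign pattern to a zero weight,
    a cyclic triangle or an acyclic one with positive entries. *)
Lemma not_ok3_escapes M x y z : ~~ ok3 x y z -> escapes M x y z.
Proof.
have rot u v w : ~~ ok3 u v w -> ~~ ok3 v (Z.opp w) (Z.opp u).
  by apply: contra => /ok3_rot /ok3_rot; rewrite !Z.opp_involutive.
have neg u v w : ~~ ok3 u v w -> ~~ ok3 (Z.opp u) (Z.opp v) (Z.opp w).
  by apply: contra => /ok3_opp; rewrite !Z.opp_involutive.
have [->|z0] := Z.eq_dec z 0; first exact: escapes_two.
have [->|x0] := Z.eq_dec x 0.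
  by move=> /rot nc; apply: escapes_rotV; apply: escapes_two.
have [->|y0] := Z.eq_dec y 0.
  by move=> /rot /rot nc; do 2!apply: escapes_rotV; apply: escapes_two.
have acyc a b c : ~~ ok3 (Zneg a) (Zneg b) (Zneg c) -> escapes M (Zneg a) (Zneg b) (Zneg c).
  by move=> /neg nc; apply: (@escapesN M (Zpos a) (Zpos b) (Zpos c)); apply: escapes_pos_acyclic.
case: x x0 => [|a|a] // _; case: y y0 => [|b|b] // _; case: z z0 => [|c|c] // _ nc.
- exact: escapes_pos_acyclic.
- exact: (proj1 (escapes_cyclic M nc)).
- by apply: escapes_rotV; apply: acyc; exact: (rot _ _ _ nc).
- by do 2!apply: escapes_rotV; apply: escapes_pos_acyclic; exact: (rot _ _ _ (rot _ _ _ nc)).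
- by do 2!apply: escapes_rotV; apply: acyc; exact: (rot _ _ _ (rot _ _ _ nc)).
- by apply: escapes_rotV; apply: escapes_pos_acyclic; exact: (rot _ _ _ nc).
- exact: (proj2 (escapes_cyclic M (neg _ _ _ nc))).
- exact: acyc.
Qed.

(** * Boundedness on a set of vertices *)

Section Boundedness.
Variable T : finType.
Implicit Types (b : T -> T -> Z) (t : seq T).

(** Mutations at vertices of [t] only involve entries inside [t], so this expresses
    mutation-finiteness of the subquiver on [t] without passing to a submatrix. *)
Definition bounded_on b t : Prop :=
  exists M, forall ks i j, {subset ks <= t} -> i \in t -> j \in t ->
    (Z.abs (foldl (@mutf T) b ks i j) <= M)%Zd.

Lemma bounded_on_mutf b t k : k \in t -> bounded_on b t -> bounded_on (mutf b k) t.
Proof.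
move=> kt [M bM]; exists M => ks i j kst it jt; apply: (bM (k :: ks)) => //.
by move=> l; rewrite inE => /orP[/eqP->|/kst].
Qed.

Lemma skew_foldl b ks : skewsym b -> skewsym (foldl (@mutf T) b ks).
Proof. by elim: ks b => //= k ks IH b /(skew_mutf k) /IH. Qed.

Lemma escapes_unbounded M x y z : escapes M x y z -> forall b i j k,
  skewsym b -> uniq [:: i; j; k] -> b i j = x -> b j k = y -> b i k = z ->
  exists ks p q, [/\ {subset ks <= [:: i; j; k]}, p \in [:: i; j; k], q \in [:: i; j; k]
    & (M < Z.abs (foldl (@mutf T) b ks p q))%Zd].
Proof.
move=> H b i j k; elim: H b => {x y z} [x y z H|x y z _ IH|x y z _ IH|x y z _ IH] b sb u ex ey ez.
  subst x y z; case: H => [H|[H|H]];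
    [exists [::], i, j|exists [::], j, k|exists [::], i, k]; by split; rewrite ?inE ?eqxx ?orbT.
all: have uu := u; move: uu; rewrite /= !inE negb_or andbT => /andP[/andP[nij nik] njk].
- have E1 : mutf b i i j = Z.opp x by rewrite /mutf eqxx -ex; case: (b i j).
  have E2 : mutf b i j k = step y (Some (Z.opp x)) (Some (Z.opp z)).
    by rewrite /mutf eq_sym (negbTE nij) eq_sym (negbTE nik) ey !(sb i) ex ez.
  have E3 : mutf b i i k = Z.opp z by rewrite /mutf eqxx -ez; case: (b i k).
  have [ks [p [q [sub pi qi lt]]]] := IH _ (skew_mutf i sb) u E1 E2 E3.
  exists (i :: ks), p, q; split=> // l; rewrite inE => /orP[/eqP->|/sub//].
  by rewrite inE eqxx.
- have E1 : mutf b j i j = Z.opp x.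
    by rewrite /mutf eqxx -ex; case: ifP => // _; case: (b i j).
  have E2 : mutf b j j k = Z.opp y by rewrite /mutf eqxx -ey.
  have E3 : mutf b j i k = step z (Some x) (Some (Z.opp y)).
    by rewrite /mutf (negbTE nij) eq_sym (negbTE njk) ez (sb j k) ex ey.
  have [ks [p [q [sub pi qi lt]]]] := IH _ (skew_mutf j sb) u E1 E2 E3.
  exists (j :: ks), p, q; split=> // l; rewrite inE => /orP[/eqP->|/sub//].
  by rewrite !inE eqxx orbT.
- have E1 : mutf b k i j = step x (Some z) (Some y).
    by rewrite /mutf (negbTE nik) (negbTE njk) ex ey ez.
  have E2 : mutf b k j k = Z.opp y.
    by rewrite /mutf eqxx -ey; case: ifP => // _; case: (b j k).
  have E3 : mutf b k i k = Z.opp z.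
    by rewrite /mutf eqxx -ez; case: ifP => // _; case: (b i k).
  have [ks [p [q [sub pi qi lt]]]] := IH _ (skew_mutf k sb) u E1 E2 E3.
  exists (k :: ks), p, q; split=> // l; rewrite inE => /orP[/eqP->|/sub//].
  by rewrite !inE eqxx !orbT.
Qed.

Lemma bounded_ok3 b t i j k : skewsym b -> bounded_on b t -> uniq [:: i; j; k] ->
  {subset [:: i; j; k] <= t} -> ok3 (b i j) (b j k) (b i k).
Proof.
move=> sb [M bM] u sub; apply/negPn/negP => /(not_ok3_escapes M) E.
have [ks [p [q [kss pi qi lt]]]] := escapes_unbounded E sb u erefl erefl erefl.
have := bM ks p q (fun l kl => sub l (kss l kl)) (sub _ pi) (sub _ qi); lia.
Qed.

Definition triples_ok b t := forall i j k, uniq [:: i; j; k] -> {subset [:: i; j; k] <= t} ->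
  ok3 (b i j) (b j k) (b i k).

Lemma triples_ok3x b x y s : ok3x (b x y) (map (b y) s) (map (b x) s) =
  all (fun z => ok3 (b x y) (b y z) (b x z)) s.
Proof. by elim: s => //= z s ->; case: (ok3 _ _ _). Qed.

Lemma triples_ok3all b t : uniq t -> triples_ok b t -> ok3all (code_of b t).
Proof.
elim: t => //= x t IH /andP[xt ut] ok.
have -> : ok3all (code_of b t).
  by apply: IH => // i j k u s; apply: ok => // l /s lt; rewrite inE lt orbT.
suff -> : ok3new (map (b x) t) (code_of b t) by [].
have: {subset t <= t} by []; move: ut; elim: {1 2 4 5}t => //= y s IHs /andP[ys us] sub.
rewrite triples_ok3x IHs //; last by move=> z zs; apply: sub; rewrite inE zs orbT.
suff -> : all (fun z => ok3 (b x y) (b y z) (b x z)) s by [].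
apply/allP => z zs; have yt : y \in t by apply: sub; rewrite inE eqxx.
have zt : z \in t by apply: sub; rewrite inE zs orbT.
apply: ok; last by move=> l; rewrite !inE => /or3P[] /eqP->; rewrite ?eqxx ?yt ?zt ?orbT.
rewrite /= !inE negb_or andbT; apply/andP; split; last by apply: contraNneq ys => ->.
by apply/andP; split; apply: contraNneq xt => ->.
Qed.

Lemma bounded_triples b t s : skewsym b -> bounded_on b s -> {subset t <= s} -> triples_ok b t.
Proof. by move=> sb bs ts i j k u sub; apply: (bounded_ok3 sb bs u) => l /sub /ts. Qed.

(** A walk succeeds only by reaching a triple that is not [ok3], while boundedness persists along
    the walk. *)
Lemma walk_unbounded b t s ks : skewsym b -> uniq t -> {subset t <= s} ->
  walk (code_of b t) ks -> ~ bounded_on b s.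
Proof.
move=> sb ut ts; elim: ks b sb => [|k ks IH] b sb /= + bs;
  rewrite (triples_ok3all ut (bounded_triples sb bs ts)) // size_code.
case: ifP => [kt|_ w]; last exact: (IH b).
have /hasP[x0 _ _] : has predT t by rewrite has_predT; lia.
rewrite (cmut_code x0 sb ut kt) => w; apply: (IH _ (skew_mutf _ sb) w).
by apply: bounded_on_mutf bs; apply/ts/mem_nth.
Qed.

(** The enumeration prunes on each final segment of [t], hence the hypothesis about every
    [drop k t]. *)
Lemma mem_extensions bad b v t :
  (forall x, x \in t -> b v x \in weights) ->
  (forall k, (k < size t)%N -> ~~ bad (code_of b (v :: drop k t))) ->
  map (b v) t \in extensions bad (code_of b t).
Proof.
elim: t => [|x t IH] // inW nbad; apply/flattenP; eexists.
  apply/mapP; exists (map (b v) t); last reflexivity.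
  apply: IH => [y yt|k kt]; first by apply: inW; rewrite inE yt orbT.
  by have := nbad k.+1 kt.
apply/flattenP; eexists.
  by apply/mapP; exists (b v x); [apply: inW; rewrite inE eqxx|reflexivity].
by have := nbad 0 isT; rewrite drop0 => /negbTE /= ->; rewrite inE.
Qed.

Lemma in_weights x : (Z.abs x <= 2)%Zd -> x \in weights.
Proof.
move=> h; have [->|[->|[->|[->|->]]]] : (x = -2 \/ x = -1 \/ x = 0 \/ x = 1 \/ x = 2)%Zd by lia.
all: by [].
Qed.

(** A common third vertex adjacent to [i] or [j] is what allows an enumeration over [weights]
    alone. *)
Lemma ok3_weight b t i j k : skewsym b -> triples_ok b t -> uniq [:: i; j; k] ->
  {subset [:: i; j; k] <= t} -> b j k <> 0%Zd \/ b i k <> 0%Zd -> (Z.abs (b i j) <= 2)%Zd.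
Proof.
move=> sb ok u sub; have := ok i j k u sub.
by move=> /ok3_small[[-> _]|[-> _]|[-> ->]|[]] // [].
Qed.

End Boundedness.

(** * The forbidden quivers *)

(* The trie only speeds up the search for a forbidden subquiver: whatever it
   returns is checked by [is_rep], so nothing is proved about it.  A leaf stores the
   positions at which the vertices of the forbidden quiver were met. *)
Inductive trie := Empty | Node of option (seq nat) & trie & trie & trie & trie & trie.

Definition child (t : trie) (x : Z) : trie :=
  match t, x with
  | Node _ a b c d e, Zneg 2 => a
  | Node _ a b c d e, Zneg 1 => b
  | Node _ a b c d e, Z0 => c
  | Node _ a b c d e, Zpos 1 => d
  | Node _ a b c d e, Zpos 2 => e
  | _, _ => Empty
  end.

Fixpoint insert (t : trie) (path : seq Z) (p : seq nat) : trie :=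
  let: (m, a, b, c, d, e) := if t is Node m a b c d e then (m, a, b, c, d, e)
     else (None, Empty, Empty, Empty, Empty, Empty) in
  match path with
  | [::] => Node (Some p) a b c d e
  | x :: path' =>
    match x with
    | Zneg 2 => Node m (insert a path' p) b c d e
    | Zneg 1 => Node m a (insert b path' p) c d e
    | Z0 => Node m a b (insert c path' p) d e
    | Zpos 1 => Node m a b c (insert d path' p) e
    | _ => Node m a b c d (insert e path' p)
    end
  end.

Definition bfs_order (m : code) (s : nat) : seq nat :=
  let n := size m in
  let fix go fuel l :=
    if fuel is f.+1 then
      let next := [seq v <- iota 0 n |
        (v \notin l) && has (fun u => ~~ Z.eqb (full_entry m u v) 0) l] in
      go f (head 0 next :: l)
    else l in go n.-1 [:: s].

(** Each quiver is inserted once per starting vertex, so that a search from a prescribed vertex can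
    meet every occurrence through it. *)
Definition insert_all (t : trie) (c : code) : trie :=
  let m := full c in
  let n := size c in
  foldl (fun t s => let l := bfs_order m s in
     insert t (flatten (rev (full_sub m l))) [seq index i l | i <- iota 0 n]) t (iota 0 n).

Fixpoint descend (t : trie) (row : seq Z) (l : seq nat) : trie :=
  match t with
  | Empty => Empty
  | _ => if l is x :: l' then descend (child t (nth 0%Zd row x)) row l' else t
  end.

Fixpoint memn (x : nat) l :=
  if l is y :: l' then (if Nat.eqb x y then true else memn x l') else false.

Fixpoint search (fuel : nat) (rows : seq (nat * seq Z)) (l : seq nat) (t : trie) :
    option (seq nat) :=
  match t with
  | Empty => None
  | Node (Some p) _ _ _ _ _ => Some (map (nth 0 l) p)
  | _ => if fuel is f.+1 then
      (fix go (rs : seq (nat * seq Z)) := match rs with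
        | [::] => None
        | (w, row) :: rs' => if memn w l then go rs' else
           match search f rows (w :: l) (descend t row l) with
           | None => go rs' | res => res end end) rows
     else None
  end.
(* The minimal mutation-infinite quivers on 4, 5 and 6 vertices with weights at most 2
   that have no subquiver mutation-equivalent to [E6] or [X6], up to isomorphism;
   completeness of the lists is not needed. *)
Definition mmi4 : seq (seq Z) := [::
  [::1;0;0;1;1;-1]; [::-1;0;0;1;1;-1]; [::-1;0;1;1;1;-1]; [::-1;-1;1;1;1;-1]; [::0;1;0;1;1;-1];
  [::0;0;1;1;1;-1]; [::-1;1;0;1;1;-1]; [::1;1;-1;1;1;-1]; [::1;1;0;1;1;-1]; [::1;1;1;1;1;-1];
  [::0;0;-1;1;1;-1]; [::-1;0;-1;1;1;-1]; [::0;-1;0;1;1;-1]; [::1;0;1;1;1;-1]; [::1;-1;1;1;1;-1];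
  [::0;1;1;1;1;-1]]%Zd.
Definition mmi5 : seq (seq Z) := [::
  [::0;1;-1;0;-1;0;0;0;-1;-1]; [::-1;-1;1;0;0;0;1;0;-1;-1]; [::-1;-1;-1;0;0;0;1;0;-1;-1];
  [::0;-1;0;0;-1;0;-1;1;0;-1]; [::1;0;0;1;-1;0;0;0;-1;-1]; [::0;1;0;1;1;-1;1;1;0;-1];
  [::1;0;1;0;-1;0;-1;1;0;-1]; [::-1;1;1;0;0;0;1;0;-1;-1]; [::-1;0;-1;0;-1;0;-1;1;0;-1];
  [::0;1;1;0;0;0;1;0;-1;-1]; [::-1;0;1;0;-1;0;0;1;0;-1]; [::0;-1;0;1;1;-1;1;1;0;-1];
  [::-1;0;1;0;1;0;1;1;0;-1]; [::-1;0;-1;0;-1;0;0;1;0;-1]; [::0;0;-1;0;1;0;1;1;0;-1];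
  [::1;0;0;1;0;-1;0;1;0;-1]; [::-1;0;-1;0;1;0;1;1;0;-1]; [::1;0;1;0;0;0;1;0;-1;-1];
  [::-1;0;1;0;-1;0;-1;1;0;-1]; [::1;0;-1;0;-1;0;0;1;0;-1]; [::0;0;1;0;-1;0;-1;1;0;-1];
  [::-1;0;0;-1;-1;0;0;0;-1;-1]; [::0;-1;-1;0;-1;0;0;0;-1;-1]; [::1;0;0;-1;-1;0;0;0;-1;-1];
  [::0;-1;0;-1;1;-1;1;1;0;-1]; [::0;-1;0;-1;-1;0;-1;1;0;-1]; [::0;0;1;0;1;0;1;1;0;-1];
  [::0;1;1;0;-1;0;0;0;-1;-1]; [::1;1;1;0;0;0;1;0;-1;-1]; [::0;-1;-1;0;0;0;1;0;-1;-1];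
  [::0;-1;1;0;0;0;1;0;-1;-1]]%Zd.
Definition mmi6 : seq (seq Z) := [::
  [::0;0;1;0;0;0;1;0;0;-1;0;0;0;-1;-1]; [::0;-2;0;1;0;0;0;0;1;0;-1;0;1;0;-1];
  [::0;0;0;0;-1;1;0;0;0;0;0;1;0;-1;-1]; [::1;0;0;0;-1;0;-1;1;1;-1;0;0;0;-1;-1];
  [::0;2;0;0;-1;0;0;1;0;0;0;1;0;-1;-1]; [::1;0;-1;0;0;0;0;0;1;0;-1;0;1;0;-1];
  [::0;0;0;0;1;1;0;0;-1;0;0;1;0;-1;-1]; [::0;1;1;-1;1;0;0;0;1;0;-1;0;1;0;-1];
  [::1;1;0;0;0;0;0;0;1;0;-1;0;1;0;-1]; [::0;-1;0;0;0;0;-2;0;1;0;0;1;0;-1;-1];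
  [::-1;1;0;0;0;0;0;1;0;0;0;1;0;-1;-1]; [::1;0;1;-1;1;0;0;1;0;0;-1;0;1;0;-1];
  [::0;-1;0;1;0;-1;0;0;0;-1;0;0;0;-1;-1]; [::1;0;-1;0;0;0;0;-1;0;-1;0;0;0;-1;-1];
  [::0;-1;1;0;0;1;0;0;0;0;0;1;1;0;-1]; [::0;0;0;0;1;0;-2;0;1;0;0;1;0;-1;-1];
  [::0;1;0;1;0;0;0;-1;0;-1;0;0;0;-1;-1]; [::-1;0;0;1;0;1;0;0;0;0;0;1;1;0;-1];
  [::0;1;0;0;0;0;0;1;0;0;-1;0;1;0;-1]; [::0;0;-1;0;0;0;-1;0;0;-1;0;0;0;-1;-1];
  [::0;1;0;0;-1;1;0;0;1;0;-1;1;1;0;-1]; [::1;0;1;0;0;0;0;1;0;0;0;1;0;-1;-1];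
  [::-2;0;0;0;1;0;0;0;-1;-1;0;0;0;-1;-1]; [::0;1;0;0;1;0;-1;0;0;-1;0;0;1;0;-1];
  [::1;0;0;0;1;-1;0;0;0;-1;0;0;0;-1;-1]; [::1;1;0;0;0;0;0;1;0;0;0;1;0;-1;-1];
  [::0;0;0;0;-1;0;-2;0;1;0;0;1;0;-1;-1]; [::1;-1;1;0;0;0;0;1;0;-1;0;1;0;-1;-1];
  [::-1;0;-1;0;0;0;0;0;1;0;-1;0;1;0;-1]; [::0;0;0;0;-1;0;0;0;-1;-1;0;0;0;-1;-1];
  [::0;0;0;0;1;0;0;0;1;0;0;1;0;-1;-1]; [::0;0;0;0;-1;1;0;0;-1;0;0;1;0;-1;-1];
  [::-1;0;-1;0;0;0;0;1;0;0;0;1;0;-1;-1]; [::0;0;0;1;0;-1;0;0;0;0;-1;0;1;0;-1];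
  [::-1;0;-1;0;0;-1;0;0;0;0;-1;0;1;0;-1]; [::0;1;0;0;0;1;0;1;0;-1;0;0;0;-1;-1];
  [::0;1;0;1;0;0;0;1;0;-1;0;0;0;-1;-1]; [::0;0;0;0;1;0;0;1;0;0;0;1;0;-1;-1];
  [::1;1;1;-1;1;0;0;1;0;0;1;0;1;0;-1]; [::0;0;0;1;0;0;0;0;1;0;-1;0;1;0;-1];
  [::0;1;1;-1;1;0;0;1;0;0;1;0;1;0;-1]; [::1;0;0;0;-1;-1;0;0;0;-1;0;0;0;-1;-1];
  [::0;-1;0;1;0;-1;0;-1;0;1;-1;1;1;0;-1]; [::0;0;0;0;1;0;0;-2;1;-1;0;1;0;-1;-1];
  [::1;0;-1;0;0;-1;0;0;0;0;-1;0;1;0;-1]; [::0;0;0;0;1;0;0;1;0;0;1;0;1;0;-1];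
  [::0;0;0;-1;0;-1;0;0;0;0;-1;0;1;0;-1]; [::0;0;0;-1;0;0;0;0;1;0;-1;0;1;0;-1];
  [::0;0;0;0;1;0;0;0;-1;0;0;-1;0;-1;-1]; [::0;0;0;1;0;0;0;1;0;0;1;0;1;0;-1];
  [::0;0;0;-1;2;0;0;1;0;0;1;0;1;0;-1]; [::-1;1;0;-1;0;-1;1;0;0;-1;0;0;0;-1;-1];
  [::1;0;0;0;-1;-1;-1;-1;1;0;0;1;0;-1;-1]; [::0;0;0;0;1;0;-1;0;1;0;0;1;0;-1;-1];
  [::-1;1;0;0;0;0;0;0;1;0;-1;0;1;0;-1]; [::1;-1;0;0;0;0;0;1;0;0;0;1;0;-1;-1];
  [::0;-1;0;1;0;0;0;0;1;1;-1;1;1;0;-1]; [::-1;-1;1;0;0;0;0;1;0;-1;0;1;0;-1;-1];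
  [::0;0;0;0;-1;0;0;1;0;0;0;1;0;-1;-1]; [::0;0;-1;0;0;0;-1;0;0;-1;0;0;1;0;-1];
  [::0;0;0;-1;0;0;0;1;0;0;1;0;1;0;-1]; [::1;0;1;0;0;0;0;0;1;0;-1;0;1;0;-1];
  [::0;0;-1;0;0;0;1;0;0;-1;0;0;0;-1;-1]; [::0;0;1;0;0;-2;1;0;0;-1;0;0;0;-1;-1];
  [::-1;-1;0;0;0;0;0;0;1;0;-1;0;1;0;-1]; [::0;0;0;0;-1;2;0;0;-1;0;0;1;0;-1;-1];
  [::-1;0;0;0;0;0;0;1;0;0;1;0;1;0;-1]; [::-1;0;-1;-1;1;0;0;0;-1;-1;0;0;0;-1;-1];
  [::0;0;0;0;-1;0;0;0;1;0;0;1;0;-1;-1]; [::1;0;-1;0;0;0;0;1;0;0;0;1;0;-1;-1];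
  [::0;1;0;1;0;0;0;0;-1;-1;0;0;0;-1;-1]; [::0;0;0;0;-1;0;0;-2;1;-1;0;1;0;-1;-1];
  [::0;0;0;0;1;0;0;0;-1;-1;0;0;0;-1;-1]; [::0;0;-1;0;0;-1;-1;-1;1;0;0;1;0;-1;-1];
  [::0;0;0;0;-1;0;0;0;-1;0;0;-1;0;-1;-1]; [::-1;-1;0;0;0;0;0;1;0;0;0;1;0;-1;-1];
  [::1;0;0;0;1;0;1;0;0;0;0;1;1;0;-1]; [::0;0;0;-1;2;-1;0;0;0;0;-1;0;1;0;-1];
  [::1;0;0;1;0;1;0;0;0;0;0;1;1;0;-1]; [::1;0;-1;0;0;0;0;0;1;1;-1;1;1;0;-1];
  [::0;0;0;-1;1;0;0;1;0;0;1;0;1;0;-1]; [::0;0;2;-1;0;0;0;0;1;0;-1;0;1;0;-1];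
  [::-1;0;0;0;-1;-1;0;0;0;-1;0;0;0;-1;-1]; [::0;1;0;1;0;0;1;0;0;-1;0;0;0;-1;-1];
  [::0;-1;0;0;0;-1;0;1;0;1;-1;1;1;0;-1]; [::0;0;0;1;0;0;-2;0;1;0;0;1;0;-1;-1];
  [::1;0;0;0;-1;0;-1;-1;1;0;0;1;0;-1;-1]]%Zd.

Definition e6 := triangle 6 [:: -1; 0; 0; 0; 0; -1; 0; 0; 0; -1; 0; 1; -1; 0; 0]%Zd.
(** The Derksen-Owen quiver X6: two oriented triangles, each with a double arrow, share vertex 5, to
    which vertex 0 is attached. *)
Definition x6 := triangle 6 [:: 0; 0; 0; 0; -1; -2; 0; 0; 1; 0; 0; -1; -2; 1; -1]%Zd.

(* Words leading from [e6] and [x6] to each isomorphism class of their mutation classes. *)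
Definition e6_words : seq (seq nat) := [::
  [::]; [::0]; [::1]; [::2]; [::3]; [::4]; [::5]; [::0;1]; [::0;2]; [::0;3]; [::0;4]; [::0;5];
  [::1;0]; [::1;2]; [::1;3]; [::1;4]; [::1;5]; [::2;1]; [::2;3]; [::2;4]; [::2;5]; [::3;2];
  [::3;4]; [::3;5]; [::4;3]; [::4;5]; [::5;2]; [::0;1;2]; [::0;1;4]; [::0;1;5]; [::0;2;1];
  [::0;2;4]; [::0;2;5]; [::0;3;2]; [::0;3;5]; [::0;4;3]; [::0;4;5]; [::1;0;2]; [::1;0;5];
  [::1;2;0]; [::1;2;3]; [::1;2;4]; [::1;2;5]; [::1;3;2]; [::1;3;5]; [::1;4;5]; [::2;1;0];
  [::2;1;3]; [::2;1;4]; [::2;1;5]; [::2;3;1]; [::2;3;5]; [::2;5;3]; [::3;4;2]; [::3;4;5];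
  [::3;5;2]; [::4;3;5]; [::5;2;3]; [::0;1;2;4]; [::0;2;1;4]; [::0;2;1;5]; [::0;3;2;1]; [::0;4;3;5];
  [::1;2;3;0]; [::1;2;3;5]; [::1;3;5;2]; [::2;1;0;4]]%N.
Definition x6_words : seq (seq nat) := [::
  [::]; [::0]; [::5]; [::0;5]; [::5;0]]%N.

(** * The forbidden list and the computed checks *)

Definition mmi : seq code :=
  map (triangle 4) mmi4 ++ map (triangle 5) mmi5 ++ map (triangle 6) mmi6.
Definition reps : seq code := mmi ++ map (cmuts e6) e6_words ++ map (cmuts x6) x6_words.
Definition reps_trie : trie := foldl insert_all Empty reps.

Definition find_rep (c : code) (starts : seq nat) : option (seq nat) :=
  let m := full c in
  let rows := zip (iota 0 (size m)) m in
  (fix go ss := if ss is s :: ss' then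
     match search 5 rows [:: s] reps_trie with None => go ss' | res => res end else None) starts.

Definition is_rep (c : code) (l : seq nat) : bool :=
  [&& uniq l, all (fun i => i < size c)%N l & has (eqcode (csub c l)) reps].

Definition wild (c : code) (starts : seq nat) : bool :=
  if ok3all c then (if find_rep c starts is Some l then is_rep c l else false) else true.

(** A neighbour for every vertex is what bounds by 2 the weights of a further vertex attached to the
    quiver. *)
Definition no_isolated (c : code) : bool := all (has (fun x => negb (Z.eqb x 0))) (full c).

(* [check_inside] and [check_outside] treat the mutations at a vertex of a forbidden
   quiver and at a vertex outside it.  In the latter case the outside vertex sits at
   position 0 and the vertex added last to the enumeration at position 1, so that only
   forbidden subquivers through position 1 have to be looked for. *)
Definition check_inside (c : code) : bool :=
  all (fun k => wild (cmut c k) (iota 0 (size c))) (iota 0 (size c)).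
Definition check_outside (c : code) : bool :=
  nilp (extensions (fun d => wild (cmut d 0) [:: 1]) c).
(** [c] is the code of [i], [j], [v] with [v] adjacent to both others. The fourth vertex enters at
    position 0, which moves [v], the mutated vertex, to position 3. *)
Definition check_triples : bool :=
  all (fun x => all (fun y => all (fun z =>
    let c := [:: [:: x; y]; [:: z]; [::]] in
    [|| Z.eqb y 0, Z.eqb z 0, ~~ ok3 x z y |
      all (fun r => ok3all (cmut (r :: c) 3)) (extensions (fun d => wild d [:: 0]) c)])
    weights) weights) weights.

Arguments wild : simpl never.
Arguments is_rep : simpl never.
Arguments find_rep : simpl never.
Arguments reps : simpl never.

Lemma check_insideT : all check_inside reps.
Proof. by vm_cast_no_check (erefl true). Qed.
Lemma check_outsideT : all check_outside reps.
Proof. by vm_cast_no_check (erefl true). Qed.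
Lemma check_triplesT : check_triples.
Proof. by vm_cast_no_check (erefl true). Qed.
Lemma no_isolated_reps : all no_isolated reps.
Proof. by vm_cast_no_check (erefl true). Qed.

(** * Tame quivers are mutation-finite *)

Section Tame.
Variable T : finType.
Implicit Types (b : T -> T -> Z) (t : seq T).

Definition tame b : Prop :=
  (forall i j k, uniq [:: i; j; k] -> ok3 (b i j) (b j k) (b i k)) /\
  (forall t, uniq t -> code_of b t \notin reps).

Lemma tame_not_wild b t starts : skewsym b -> tame b -> uniq t ->
  ~~ wild (code_of b t) starts.
Proof.
move=> sb [ok nr] ut; rewrite /wild triples_ok3all //; last by move=> i j k u _; exact: ok.
case: (find_rep _ _) => // l; apply/negP => /and3P[ul lt /hasP[P Prep /eqcodeP eP]].
case: t ut lt eP => [|x t] ut lt eP.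
  case: l lt ul eP => //= _ _ eP; move: Prep; rewrite -eP.
  by have := nr [::] isT => /negP.
move: lt; rewrite size_code => lt.
have := nr (map (nth x (x :: t)) l); rewrite -(csub_code x sb lt) eP Prep.
rewrite map_inj_in_uniq // => [/(_ ul)//|p q /(allP lt) pt /(allP lt) qt /eqP].
by rewrite nth_uniq // => /eqP.
Qed.

Lemma has_nonzero_code b t x : skewsym b -> no_isolated (code_of b t) -> x \in t ->
  exists2 y, y \in t & b x y <> 0%Zd.
Proof.
move=> sb; rewrite /no_isolated full_code // => /allP ni xt.
have /ni /hasP[_ /mapP[y yt ->] nz] : map (b x) t \in [seq [seq b x y | y <- t] | x <- t].
  by apply/mapP; exists x.
by exists y => //; lia.
Qed.

(** Mutating back at [v] recovers the tame [b], so the row of [v] would survive the pruning in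
    [check_outside], which leaves no row. *)
Lemma tame_outside b v t : skewsym b -> tame b -> v \notin t -> uniq t ->
  code_of (mutf b v) t \notin reps.
Proof.
move=> sb tb vt ut; apply/negP => rep.
have sb' := skew_mutf v sb.
have /nilP nil := allP check_outsideT _ rep.
have ni := allP no_isolated_reps _ rep.
suff : map (mutf b v v) t \in extensions (fun d => wild (cmut d 0) [:: 1]) (code_of (mutf b v) t).
  by rewrite nil.
have nv x : x \in t -> (v == x) = false.
  by move=> xt; apply: contraNF vt => /eqP->.
apply: mem_extensions => [x xt|k kt]; last first.
  rewrite (cmut_code v sb') ?size_code //=; last first.
    by rewrite drop_uniq // andbT; apply: contra vt; exact: mem_drop.
  set c := (X in wild X _).
  have -> : c = code_of b (v :: drop k t).
    rewrite /c -/(code_of (mutf (mutf b v) v) (v :: drop k t)).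
    by apply: eq_code_of => i j; exact: mutf_involutive.
  by apply: tame_not_wild => //=; rewrite drop_uniq // andbT; apply: contra vt; exact: mem_drop.
apply: in_weights; have -> : mutf b v v x = Z.opp (b v x).
  by rewrite /mutf eqxx; case: (b v x).
rewrite Z.abs_opp; have [y yt nz] := has_nonzero_code sb' ni xt.
have u : uniq [:: v; x; y].
  rewrite /= !inE (nv x xt) (nv y yt) /= andbT; apply: contraPneq nz => ->.
  by rewrite skew_diag //; exact: skew_mutf.
apply: (@ok3_weight _ b [:: v; x; y] v x y) => // [i j k uu _|]; first exact: tb.1.
(* If [v] and [y] are not adjacent, the entry at [x], [y] is unchanged by the mutation, hence
   nonzero in [b]. *)
have [e|ne] := Z.eq_dec (b v y) 0; last by right.
left => e'; apply: nz; rewrite /mutf eq_sym (nv _ xt) eq_sym (nv _ yt) e'.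
by rewrite (sb v y) e; case: (b x v).
Qed.

Lemma tame_inside b v t : skewsym b -> tame b -> v \in t -> uniq t ->
  code_of (mutf b v) t \notin reps.
Proof.
move=> sb tb vt ut; apply/negP => rep.
have sb' := skew_mutf v sb.
have := allP check_insideT _ rep; rewrite /check_inside size_code => /allP/(_ (index v t)).
rewrite mem_iota /= add0n index_mem vt (cmut_code v sb') // ?index_mem // nth_index // => /(_ isT).
rewrite (eq_code_of (b' := b)); last by move=> i j; exact: mutf_involutive.
by apply/negP; exact: tame_not_wild.
Qed.

Lemma ok3_perm12 b i j k : skewsym b -> ok3 (b j i) (b i k) (b j k) -> ok3 (b i j) (b j k) (b i k).
Proof. by move=> sb /ok3_swap12; rewrite -sb. Qed.

Lemma ok3_perm23 b i j k : skewsym b -> ok3 (b i k) (b k j) (b i j) -> ok3 (b i j) (b j k) (b i k).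
Proof. by move=> sb /ok3_swap23; rewrite -sb. Qed.

(** The two edges at [v] force all weights among the four vertices to be at most 2, so
    [check_triples] covers them. *)
Lemma tame_triple_adjacent b v i j l : skewsym b -> tame b -> uniq [:: l; i; j; v] ->
  b i v <> 0%Zd -> b j v <> 0%Zd ->
  ok3 (mutf b v l i) (mutf b v i j) (mutf b v l j).
Proof.
move=> sb tb u iv jv; have [ok _] := tb.
have : uniq [:: l; i; j; v] by [].
rewrite /= !inE !negb_or !andbT => /and3P[/and3P[nli nlj nlv] /andP[nij niv] njv].
have uij : uniq [:: i; j; v] by rewrite /= !inE !negb_or nij niv njv.
have uli : uniq [:: l; i; v] by rewrite /= !inE !negb_or nli nlv niv.
have ulj : uniq [:: l; j; v] by rewrite /= !inE !negb_or nlj nlv njv.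
have [sij siv sjv] : [/\ Z.abs (b i j) <= 2, Z.abs (b i v) <= 2 & Z.abs (b j v) <= 2]%Zd.
  by have /ok3_small[[_ ]|[_ ]|[]|[? ? ?]] := ok _ _ _ uij.
have sli : (Z.abs (b l i) <= 2)%Zd by have /ok3_small[[_ ]|[]|[]|[? ? ?]] := ok _ _ _ uli => // ->.
have slj : (Z.abs (b l j) <= 2)%Zd by have /ok3_small[[_ ]|[]|[]|[? ? ?]] := ok _ _ _ ulj => // ->.
have slv : (Z.abs (b l v) <= 2)%Zd.
  by have /ok3_small[[_ ]|[_ ->]|[]|[? ? ?]] := ok _ _ _ uli.
have := check_triplesT; rewrite /check_triples => /allP/(_ _ (in_weights sij)).
move=> /allP/(_ _ (in_weights siv)) /allP/(_ _ (in_weights sjv)).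
move=> /or4P[/Z.eqb_eq//|/Z.eqb_eq//|/negP[]|]; first exact: ok.
move=> /allP/(_ (map (b l) [:: i; j; v])).
have um : l \notin [:: i; j; v] by case/andP: u.
have -> : map (b l) [:: i; j; v] \in extensions (fun d => wild d [:: 0]) (code_of b [:: i; j; v]).
  apply: mem_extensions => [x|k _].
    rewrite in_cons in_cons mem_seq1 => /or3P[]/eqP->.
  - exact: in_weights sli.
  - exact: in_weights slj.
  - exact: in_weights slv.
  refine (tame_not_wild _ sb tb _).
  rewrite cons_uniq drop_uniq // andbT; apply: contra um; exact: mem_drop.
move=> /(_ isT).
rewrite -[_ :: _]/(code_of b [:: l; i; j; v]) (cmut_code l sb u) //=.
by case: (ok3 _ _ _).
Qed.

End Tame.

Section TameClass.
Variable T : finType.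
Implicit Types (b : T -> T -> Z) (t : seq T).

Lemma mutf_nonadjacent b v p q : p != v -> q != v -> b p v = 0%Zd \/ b q v = 0%Zd ->
  mutf b v p q = b p q.
Proof.
move=> pv qv; rewrite /mutf (negbTE pv) (negbTE qv) => -[]->; first by case: (b q v).
by case: (b p v).
Qed.

Lemma tame_triple_first b i j k : skewsym b -> tame b -> uniq [:: i; j; k] ->
  ok3 (mutf b i i j) (mutf b i j k) (mutf b i i k).
Proof.
move=> sb [ok _] u; have c := ok3_mut (ok _ _ _ u).
move: u; rewrite /= !inE !negb_or !andbT => /andP[/andP[ij ik] _].
have -> : mutf b i i j = Z.opp (b i j) by rewrite /mutf eqxx; case: (b i j).
have -> : mutf b i i k = Z.opp (b i k) by rewrite /mutf eqxx; case: (b i k).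
by rewrite /mutf eq_sym (negbTE ij) eq_sym (negbTE ik) !(sb i).
Qed.

Lemma uniq_perm12 (i j k : T) : uniq [:: i; j; k] -> uniq [:: j; i; k].
Proof. move=> u; by rewrite (perm_uniq (s2 := [:: i; j; k])) //; apply/permP => a /=; lia. Qed.

Lemma uniq_perm23 (i j k : T) : uniq [:: i; j; k] -> uniq [:: i; k; j].
Proof. move=> u; by rewrite (perm_uniq (s2 := [:: i; j; k])) //; apply/permP => a /=; lia. Qed.

Lemma tame_mutf b v : skewsym b -> tame b -> tame (mutf b v).
Proof.
move=> sb tb; have sb' := skew_mutf v sb; split=> [i j k u|t ut]; last first.
  by case: (boolP (v \in t)) => vt; [exact: tame_inside | exact: tame_outside].
have [vi|iv] := eqVneq i v; first by subst v; exact: tame_triple_first.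
have [vj|jv] := eqVneq j v.
  by subst v; apply: ok3_perm12 => //; apply: tame_triple_first => //; exact: uniq_perm12.
have [vk|kv] := eqVneq k v.
  subst v; apply: ok3_perm23 => //; apply: ok3_perm12 => //; apply: tame_triple_first => //.
  exact/uniq_perm12/uniq_perm23.
have adj (l p q : T) : uniq [:: l; p; q] -> l != v -> p != v -> q != v -> uniq [:: l; p; q; v].
  by rewrite /= !inE !negb_or !andbT => /andP[/andP[-> ->] ->] -> -> ->.
have [zi|nzi] := Z.eq_dec (b i v) 0; have [zj|nzj] := Z.eq_dec (b j v) 0;
  have [zk|nzk] := Z.eq_dec (b k v) 0.
(* With at most one of the three vertices adjacent to [v] the triple is unchanged. Otherwise two
   adjacent ones are moved to the last two places. *)
all: try by rewrite !mutf_nonadjacent //; (exact: tb.1) || tauto.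
- by apply: tame_triple_adjacent => //; exact: adj.
- apply: ok3_perm12 => //; apply: tame_triple_adjacent => //.
  by apply: adj => //; exact: uniq_perm12.
- apply: ok3_perm23 => //; apply: ok3_perm12 => //; apply: tame_triple_adjacent => //.
  by apply: adj => //; exact/uniq_perm12/uniq_perm23.
- by apply: tame_triple_adjacent => //; exact: adj.
Qed.

(** Apart from signs, an entry changes only if both ends are adjacent to [v]; the mutated triple
    with [v] is then [ok3] with two nonzero edges, so its weights are at most 2. *)
Lemma tame_weight_mutf b v M i j : skewsym b -> tame b -> (2 <= M)%Zd ->
  (forall p q, (Z.abs (b p q) <= M)%Zd) -> (Z.abs (mutf b v i j) <= M)%Zd.
Proof.
move=> sb tb M2 bM.
have [vi|iv] := eqVneq i v.
  by rewrite /mutf vi eqxx /= Z.abs_opp.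
have [vj|jv] := eqVneq j v.
  by rewrite /mutf vj eqxx (negbTE iv); move: (bM i v); case: (b i v).
have [zi|nzi] := Z.eq_dec (b i v) 0; first by rewrite mutf_nonadjacent //; left.
have [zj|nzj] := Z.eq_dec (b j v) 0; first by rewrite mutf_nonadjacent //; right.
have [eij|nij] := eqVneq i j; first by rewrite eij skew_diag //=; [lia | exact: skew_mutf].
have u : uniq [:: i; j; v] by rewrite /= !inE !negb_or nij iv jv.
have := (tame_mutf v sb tb).1 _ _ _ u.
have e p : p != v -> mutf b v p v = Z.opp (b p v).
  by move=> pv; rewrite /mutf (negbTE pv) eqxx; case: (b p v).
rewrite !e // => /ok3_small[[]|[]|[]|[]]; lia.
Qed.

Lemma tame_bounded b s : skewsym b -> tame b -> bounded_on b s.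
Proof.
move=> sb tb.
have [M M2 bM] : exists2 M, (2 <= M)%Zd & forall p q, (Z.abs (b p q) <= M)%Zd.
  exists (2 + Z.of_nat (\sum_(x : T * T) Z.to_nat (Z.abs (b x.1 x.2)))%N)%Zd; first lia.
  move=> p q; set S := (\sum_(x : T * T) _)%N.
  have : (Z.to_nat (Z.abs (b p q)) <= S)%N by rewrite /S (bigD1 (p, q)) //= leq_addr.
  lia.
exists M => ks i j _ _ _; elim: ks b sb tb bM i j => //= k ks IH b sb tb bM i j.
apply: IH; [exact: skew_mutf|exact: tame_mutf|] => p q; exact: tame_weight_mutf.
Qed.

End TameClass.

(** * Quivers containing E6 or X6 *)

(* [(r, w, p)]: attaching a vertex to E6 (resp. E7) by the row [r], mutating along [w] and
   reading the vertices in the order [p] gives E7 (resp. E8). *)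
Definition up6 : seq (seq Z * seq nat * seq nat) := [::
  ([:: 0; -1; 1; 0; 0; -1]%Zd, [:: 1; 3; 4; 5; 6], [:: 0; 3; 4; 5; 2; 1; 6]);
  ([:: -1; 0; 1; 0; 0; -1]%Zd, [:: 0; 3; 4; 5; 2; 6], [:: 1; 3; 4; 5; 0; 6; 2]);
  ([:: 0; 0; 0; 1; 0; -1]%Zd, [:: 0; 6], [:: 1; 2; 3; 6; 4; 5; 0]);
  ([:: 0; 0; 0; 0; 1; -1]%Zd, [:: 6; 0; 5; 4], [:: 1; 2; 3; 5; 0; 6; 4]);
  ([:: 0; 0; 0; 0; -1; 0]%Zd, [:: 2; 1; 4; 5; 0], [:: 4; 0; 5; 3; 1; 2; 6]);
  ([:: -1; 0; 0; 0; 0; 0]%Zd, [::], [:: 0; 1; 2; 3; 4; 5; 6]);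
  ([:: 1; 0; 0; 0; 0; 0]%Zd, [:: 0], [:: 0; 1; 2; 3; 4; 5; 6]);
  ([:: -1; 1; 0; 0; 0; 0]%Zd, [:: 0], [:: 1; 0; 2; 3; 4; 5; 6]);
  ([:: 0; -1; 1; 0; 0; 0]%Zd, [:: 0], [:: 1; 2; 0; 3; 4; 5; 6]);
  ([:: 0; 0; -1; 1; 0; 0]%Zd, [:: 2; 1; 4; 5], [:: 0; 4; 5; 3; 1; 2; 6]);
  ([:: 0; -1; 0; 1; 0; 0]%Zd, [:: 0; 4; 5; 0; 6], [:: 1; 2; 4; 5; 3; 6; 0]);
  ([:: 0; 0; 0; -1; 1; 0]%Zd, [:: 2; 1; 4; 0; 5], [:: 0; 4; 5; 3; 1; 2; 6]);
  ([:: -1; 0; 0; 0; 1; 0]%Zd, [:: 0; 1; 2; 3; 6], [:: 0; 1; 2; 6; 3; 5; 4]);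
  ([:: 0; 0; 0; 0; 1; 0]%Zd, [:: 2; 1; 4; 5; 0], [:: 4; 5; 0; 3; 1; 2; 6])].
Definition up7 : seq (seq Z * seq nat * seq nat) := [::
  ([:: 0; -1; 0; 1; 0; 0; -1]%Zd, [:: 0; 4; 5; 6; 3; 7], [:: 1; 2; 4; 5; 6; 0; 7; 3]);
  ([:: 0; 0; 0; 0; 1; 0; -1]%Zd, [:: 0; 7], [:: 1; 2; 3; 4; 7; 5; 6; 0]);
  ([:: 0; 0; 0; 0; 0; 1; -1]%Zd, [:: 7; 0; 6; 5], [:: 1; 2; 3; 4; 6; 0; 7; 5]);
  ([:: -1; 0; 0; 0; 0; 0; 0]%Zd, [::], [:: 0; 1; 2; 3; 4; 5; 6; 7]);
  ([:: 1; 0; 0; 0; 0; 0; 0]%Zd, [:: 0], [:: 0; 1; 2; 3; 4; 5; 6; 7]);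
  ([:: -1; 1; 0; 0; 0; 0; 0]%Zd, [:: 0], [:: 1; 0; 2; 3; 4; 5; 6; 7]);
  ([:: 0; -1; 1; 0; 0; 0; 0]%Zd, [:: 0], [:: 1; 2; 0; 3; 4; 5; 6; 7]);
  ([:: 0; 0; -1; 1; 0; 0; 0]%Zd, [:: 0], [:: 1; 2; 3; 0; 4; 5; 6; 7]);
  ([:: 0; 0; -1; 0; 1; 0; 0]%Zd, [:: 0; 5; 6; 0; 7], [:: 1; 2; 3; 5; 6; 4; 7; 0]);
  ([:: -1; 0; 0; 0; 0; 1; 0]%Zd, [:: 0; 1; 2; 3; 4; 7], [:: 0; 1; 2; 3; 7; 4; 6; 5])].
(* Walks found by random search: each mutation-infinite extension that has to be
   excluded is detected by one of them. *)
Definition pool6 : seq (seq nat) := [::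
  [::1;7;5;1;5;6;0;4;3;0;5;0;3;1;0;3;6;3;7;2;5;2;0;2;7;1;4;0;6;4;6;3;6;1;6;1;2;4;2;6];
  [::4;1;7;1;0;6;3;5;1;5;2;7;1;6;7;4;7;5;0;6;0;7;4;7;3;5;3;1;0;2;7;6;4;6;4;6;0;6;1]].
Definition pool7 : seq (seq nat) := [::
  [::1;6;1;3;5;2;7;3;7;4;8;7;1;8;4;5;4;0;4;3;6;8;2;3;4;1;7;3;1;4;8;3;1;2;1;8;3;2;7];
  [::8;5;6;5;8;7;3;7;5;8;4;3;5;1;2;8;6;7;8;3;5;7;6;2;0;1;6;3;7;1;8;5;7;6;1;0;1;8;4];
  [::2;3;0;5;2;8;1;7;3;0;4;5;6;8;7;5;3;4;8;2;3;0;5;1;0;3;5;8;4;2;6;4;5;4;7;5;8;1;0]].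
Definition pool8 : seq (seq nat) := [::
  
  [::7;3;4;9;4;2;6;0;5;3;9;4;0;8;0;7;6;2;7;5;3;9;5;3;4;1;
     9;2;0;5;4;2;6;7;3;5;0;1;3;0;9;6;0;9;4;1;8;1;3;2];
  [::2;5;8;1;9;5;1;6;2;7;0;8;4;5;3;1;7;1;8;9;5;1;8;9;0;2;
     0;5;7;2;9;4;6;5;0;5;8;7;2;0;6;3;1;9;3;8;4;5;1;8];
  [::7;9;4;3;6;7;5;4;9;3;4;7;4;1;0;7;2;9;1;7;1;9;4;6;2;5;
     8;1;2;0;6;7;5;4;2;3;4;1;3;5;4;7;0;4;3;9;4;6;5;8];
  [::9;7;6;1;0;4;8;1;6;5;3;0;6;8;9;8;1;9;2;0;1;9;1;7;4;6;5;8;2;4;5;4;8;5;9;3;2;5;7;9;5;1;8;4;7;5;4];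
  [::2;7;5;6;9;1;8;1;7;4;1;3;5;6;9;6;3;4;2;7;2;3;7;1;6;
     2;0;3;4;2;9;7;5;2;8;3;8;6;0;2;3;2;1;6;4;6;9;0;5];
  [::1;5;3;5;4;1;4;0;6;8;3;4;5;2;7;6;0;2;6;9;3;0;7;2;3;2;1;5;3;8;5;1;2;0;1;3;5;7;4;9;6;4;7;5]].

(** Two rounds through up to 10 positions: a cheap test for pruning, after which the pool is tried
    on the survivors only. *)
Definition short_walk : seq nat := iota 0 10 ++ iota 0 10.

Definition e7 : code := triangle 7
  [:: -1;0;0;0;0;0; -1;0;0;0;0; -1;0;0;0; -1;0;1; -1;0;0]%Zd.
Definition e8 : code := triangle 8
  [:: -1;0;0;0;0;0;0; -1;0;0;0;0;0; -1;0;0;0;0; -1;0;0;0; -1;0;1; -1;0;0]%Zd.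

Definition finite_extensions (pool : seq (seq nat)) (c : code) : seq (seq Z) :=
  [seq r <- extensions (fun d => walk d short_walk) c | ~~ has (walk (r :: c)) pool].

Definition zrow (r : seq Z) : bool := all (Z.eqb 0) r.
Definition mem_row (r : seq Z) (l : seq (seq Z)) : bool := has (eqrow r) l.

Definition upgrade := (seq Z * seq nat * seq nat)%type.
Definition check_upgrade (s s' : code) (u : upgrade) : bool :=
  let: (r, w, p) := u in let n := (size s).+1 in
  [&& all (fun i => i < n)%N w, all (fun i => i < n)%N p, uniq p, size p == n
    & eqcode (csub (cmuts (r :: s) w) p) s'].

(* The extensions that do not lead to the next quiver of the E-series: these must
   be shown not to occur for three vertices simultaneously. *)
Definition deltas pool (ups : seq upgrade) (s : code) : seq (seq Z) :=
  [seq r <- finite_extensions pool s | ~~ mem_row r [seq u.1.1 | u <- ups]].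
Definition delta_pairs pool (D : seq (seq Z)) (s : code) (r : seq Z) : seq (seq Z) :=
  [seq q <- finite_extensions pool (r :: s) | ~~ zrow q && mem_row (behead q) D].

(** A row [q] attaches a second vertex beside the one attached by [r]: its head is the entry between
    the two, its tail the row towards [s]. The tail must be nonzero, and no third row may be a
    partner of both. *)
Definition check_stage pool (ups : seq upgrade) (s s' : code) : bool :=
  let D := deltas pool ups s in
  let table := [seq (r, delta_pairs pool D s r) | r <- [seq r <- D | ~~ zrow r]] in
  [&& no_isolated s, all (check_upgrade s s') ups &
    all (fun e => all (fun q => ~~ zrow (behead q) &&
      all (fun e' => if eqrow e'.1 (behead q) then
         all (fun q' => ~~ mem_row (behead q') (map behead e'.2)) e.2 else true) table) e.2) table].

Lemma check_e6 : check_stage pool6 up6 e6 e7.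
Proof. by vm_cast_no_check (erefl true). Qed.
Lemma check_e7 : check_stage pool7 up7 e7 e8.
Proof. by vm_cast_no_check (erefl true). Qed.
Lemma check_e8 : check_stage pool8 [::] e8 [::].
Proof. by vm_cast_no_check (erefl true). Qed.
Lemma check_x6 : check_stage [::] [::] x6 [::].
Proof. by vm_cast_no_check (erefl true). Qed.

(** * Attaching vertices inside a connected quiver *)

Section Extension.
Variable T : finType.
Implicit Types (b : T -> T -> Z) (t : seq T).

Definition connected b : Prop := forall (s : seq T) x y, x \in s -> y \notin s ->
  exists p q, [/\ p \in s, q \notin s & b p q <> 0%Zd].

(* Unlike minimality, this is preserved by mutations at the vertices of [t]. *)
Definition extensible b t : Prop := [/\ skewsym b, connected b &
  forall s, uniq s -> (size s <= 10)%N -> {subset t <= s} -> bounded_on b s].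

(** If the mutated quiver has no edge across the cut, mutating back creates none: of the edges from
    [k] to [p] and to [q], one crosses the cut and vanishes. *)
Lemma connected_mutf b k : skewsym b -> connected b -> connected (mutf b k).
Proof.
move=> sb cb s x y xs ys.
have [/existsP[p /existsP[q /and3P[ps qs nz]]]|no] :=
  boolP [exists p, exists q, [&& p \in s, q \notin s & negb (Z.eqb (mutf b k p q) 0)]].
  by exists p, q; split=> //; lia.
have [p [q [ps qs]]] := cb s x y xs ys; case.
have zero u v : u \in s -> v \notin s -> mutf b k u v = 0%Zd.
  move=> us vs; apply/Z.eqb_spec/negPn; move/existsPn/(_ u)/existsPn/(_ v): no.
  by rewrite us vs.
have zero' u v : u \notin s -> v \in s -> mutf b k u v = 0%Zd.
  by move=> us vs; rewrite (skew_mutf k sb v u) zero.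
rewrite -(mutf_involutive k p q sb) {1}/mutf zero //.
have [ks|ks] := boolP (k \in s).
  by rewrite (zero' q k) //; case: ifP => //; case: ifP => // _ _; case: (mutf _ _ _ _).
by rewrite (zero p k) //; case: ifP => //; case: ifP => // _ _; case: (mutf _ _ _ _).
Qed.

Lemma extensibleS b t t' : {subset t <= t'} -> extensible b t -> extensible b t'.
Proof. by move=> sub [sb cb fb]; split=> // s us ss st; apply: fb => // x /sub /st. Qed.

Lemma extensible_foldl b t ks : {subset ks <= t} -> extensible b t ->
  extensible (foldl (@mutf T) b ks) t.
Proof.
elim: ks b => //= k ks IH b sub [sb cb fb]; apply: IH => [l lks|].
  by apply: sub; rewrite inE lks orbT.
have kt : k \in t by apply: sub; rewrite inE eqxx.
split=> [||s us ss st]; [exact: skew_mutf|exact: connected_mutf|].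
by apply: bounded_on_mutf; [exact: st|exact: fb].
Qed.

Lemma cmuts_code b t w x0 : skewsym b -> uniq t -> all (fun i => i < size t)%N w ->
  cmuts (code_of b t) w = code_of (foldl (@mutf T) b (map (nth x0 t) w)) t.
Proof.
move=> sb ut; elim: w b sb => //= k w IH b sb /andP[kt wt].
by rewrite /cmuts /= (cmut_code x0) // -/(cmuts _ w) IH //; exact: skew_mutf.
Qed.

Lemma mem_finite_extensions pool b v t : skewsym b -> uniq (v :: t) ->
  bounded_on b (v :: t) -> (forall x, x \in t -> exists2 y, y \in t & b x y <> 0%Zd) ->
  map (b v) t \in finite_extensions pool (code_of b t).
Proof.
move=> sb uvt bd nb; have /andP[vt ut] := uvt; rewrite mem_filter; apply/andP; split.
  apply/hasPn => w _; apply/negP; rewrite -[_ :: _]/(code_of b (v :: t)) => wk.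
  exact: (walk_unbounded sb uvt (fun _ => id) wk bd).
apply: mem_extensions => [x xt|k kt].
  have [y yt nz] := nb x xt; apply: in_weights.
  apply: (@ok3_weight _ b (v :: t) v x y) => //; last by left.
  - exact: bounded_triples sb bd (fun _ => id).
  - rewrite /= !inE andbT; apply/andP; split.
      by rewrite negb_or; apply/andP; split; apply: contraNneq vt => ->.
    by apply/eqP => e; apply: nz; rewrite e skew_diag.
  - by move=> z; rewrite !inE => /or3P[]/eqP->; rewrite ?eqxx ?xt ?yt ?orbT.
have sub : {subset v :: drop k t <= v :: t}.
  by move=> z; rewrite !inE => /orP[->//|/mem_drop ->]; rewrite orbT.
have ud : uniq (v :: drop k t).
  by rewrite cons_uniq drop_uniq // andbT; apply: contra vt; exact: mem_drop.
by apply/negP => wk; exact: (walk_unbounded sb ud sub wk bd).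
Qed.

Lemma mem_rowE r l : mem_row r l = (r \in l).
Proof.
apply/hasP/idP => [[q ql /eqrowP->]//|rl].
by exists r => //; apply/eqrowP.
Qed.

Lemma zrowPn b x t : ~~ zrow (map (b x) t) -> exists2 y, y \in t & b x y <> 0%Zd.
Proof.
by rewrite -has_predC => /hasP[_ /mapP[y yt ->] nz]; exists y => // e; move: nz; rewrite e.
Qed.

Lemma zrowN b x t y : y \in t -> b x y <> 0%Zd -> ~~ zrow (map (b x) t).
Proof.
move=> yt nz; rewrite -has_predC; apply/hasP; exists (b x y); first exact: map_f.
by apply/negP => /Z.eqb_spec e; exact: nz.
Qed.

Lemma attached b t : skewsym b -> connected b -> (0 < size t < #|T|)%N ->
  exists2 v, v \notin t & ~~ zrow (map (b v) t).
Proof.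
move=> sb cb /andP[t0 tT]; have /hasP[x xt _] : has predT t by rewrite has_predT.
have [y yt] : exists y, y \notin t.
  apply/existsP; apply: contraTT tT => /existsPn all_t; rewrite -leqNgt.
  apply: leq_trans (card_size t); apply: subset_leq_card; apply/subsetP => y _.
  by apply/negPn.
have [p [q [pt qt nz]]] := cb t x y xt yt; exists q => //.
by apply: (zrowN (y := p)) => //; rewrite (sb p q); lia.
Qed.

(** Either some vertex is attached by an upgrade, or three vertices attached in turn contradict the
    table. The bound 8 keeps [t] with two more vertices within the 10 for which boundedness is
    known. *)
Lemma stage pool ups s s' b t : check_stage pool ups s s' -> (10 < #|T|)%N ->
  code_of b t = s -> uniq t -> (0 < size t <= 8)%N -> extensible b t ->
  exists2 u, u \in ups & exists b' t', [/\ extensible b' t', uniq t',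
    size t' = (size t).+1 & code_of b' t' = s'].
Proof.
move=> chk T10 cs ut /andP[t0 t8] ext; have [sb cb fb] := ext.
move: chk; rewrite /check_stage; set D := deltas _ _ _.
pose ext2 := delta_pairs pool D s.
set table := map _ _; case/and3P; rewrite -{1}cs => ni /allP up /allP chk.
have [/existsP[v /andP[vt /mapP[[[r w] p] ru e]]]|none] :=
    boolP [exists v, (v \notin t) && (map (b v) t \in [seq u.1.1 | u <- ups])].
  exists (r, w, p) => //; have := up _ ru; rewrite /check_upgrade -cs size_code.
  case/and5P=> wn pn upp /eqP sp /eqcodeP code'.
  have uvt : uniq (v :: t) by rewrite /= vt.
  have extv : extensible b (v :: t) by apply: extensibleS ext => x; rewrite inE orbC => ->.
  set b' := foldl (@mutf T) b (map (nth v (v :: t)) w).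
  have nths (l : seq nat) : all (fun i => i < (size t).+1)%N l ->
      {subset map (nth v (v :: t)) l <= v :: t}.
    by move=> /allP lt x /mapP[i /lt it ->]; exact: mem_nth.
  exists b', (map (nth v (v :: t)) p); split.
  - apply: extensibleS (extensible_foldl (nths _ wn) extv) => x xvt.
    apply/mapP; exists (index x (v :: t)); last by rewrite nth_index.
    have sub : {subset p <= iota 0 (size t).+1} by move=> i /(allP pn); rewrite mem_iota.
    have [|_ ->] := uniq_min_size upp sub; first by rewrite size_iota sp.
    by rewrite mem_iota add0n -[(size t).+1]/(size (v :: t)) index_mem.
  - rewrite map_inj_in_uniq // => i j /(allP pn) it /(allP pn) jt /eqP.
    by rewrite nth_uniq // => /eqP.
  - by rewrite size_map sp.
  - rewrite -(csub_code v _ (t := v :: t)) //; last exact: skew_foldl.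
    by rewrite -(cmuts_code v sb uvt wn) /= (e : map (b v) t = r).
exfalso.
have nt x : x \in t -> exists2 y, y \in t & b x y <> 0%Zd by exact: has_nonzero_code.
have inD v : v \notin t -> map (b v) t \in D.
  move=> vt; rewrite mem_filter mem_rowE; apply/andP; split.
    by move/existsPn/(_ v): none; rewrite vt.
  rewrite -cs; apply: mem_finite_extensions => //=; first by rewrite vt.
  by apply: fb; rewrite /= ?vt //; [lia | move=> x; rewrite inE orbC => ->].
have in_ext2 v1 v2 : uniq [:: v2, v1 & t] -> ~~ zrow (map (b v1) t) ->
    ~~ zrow (map (b v2) (v1 :: t)) -> map (b v2) (v1 :: t) \in ext2 (map (b v1) t).
  move=> u nz1 nz2; rewrite mem_filter nz2 mem_rowE inD /=; last first.
    by move: u; rewrite /= inE negb_or => /andP[/andP[]].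
  rewrite -cs; apply: (mem_finite_extensions _ (t := v1 :: t)) => //.
    by apply: fb => // x; rewrite !inE => ->; rewrite !orbT.
  have [z zt nzz] := zrowPn nz1; move=> x; rewrite inE => /orP[/eqP->|/nt[y yt]].
    by exists z => //; rewrite inE zt orbT.
  by exists y => //; rewrite inE yt orbT.
have in_table v : v \notin t -> ~~ zrow (map (b v) t) ->
    (map (b v) t, ext2 (map (b v) t)) \in table.
  by move=> vt nz; apply/mapP; exists (map (b v) t) => //; rewrite mem_filter nz inD.
have [v1 v1t nz1] : exists2 v, v \notin t & ~~ zrow (map (b v) t).
  by apply: attached => //; rewrite t0; apply: leq_ltn_trans T10; apply: leq_trans t8 _.
have [v2 v2t nz2'] : exists2 v, v \notin v1 :: t & ~~ zrow (map (b v) (v1 :: t)).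
  by apply: attached => //; apply: leq_ltn_trans T10; exact: leqW.
have u2 : uniq [:: v2, v1 & t] by rewrite /= v2t v1t.
have [v3 v3t nz3'] : exists2 v, v \notin [:: v2, v1 & t] & ~~ zrow (map (b v) [:: v2, v1 & t]).
  by apply: attached => //; apply: leq_ltn_trans T10.
have {chk} chk v w : uniq [:: w, v & t] -> ~~ zrow (map (b v) t) ->
    ~~ zrow (map (b w) (v :: t)) -> ~~ zrow (map (b w) t) /\
    all (fun e' => if eqrow e'.1 (map (b w) t) then
      all (fun q' => ~~ mem_row (behead q') (map behead e'.2)) (ext2 (map (b v) t))
      else true) table.
  move=> u nzv nzw; have vt : v \notin t by case/and3P: u.
  by have /andP := allP (chk _ (in_table v vt nzv)) _ (in_ext2 _ _ u nzv nzw).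
have {v2t} v2t : v2 \notin t by move: v2t; rewrite inE negb_or => /andP[].
have [nz2 /allP/(_ _ (in_table _ v2t _)) chk2] := chk _ _ u2 nz1 nz2'.
have u31 : uniq [:: v3, v1 & t] by move: v3t; rewrite /= !inE !negb_or v1t => /and3P[_ -> ->].
have u32 : uniq [:: v3, v2 & t] by move: v3t; rewrite /= !inE !negb_or v2t => /and3P[-> _ ->].
(* The neighbour of [v3] given by connectedness may be [v1] or [v2]; the table then forces one in
   [t]. *)
have nz3 : ~~ zrow (map (b v3) t).
  have [y] := zrowPn nz3'; rewrite inE => /orP[/eqP->|yt] nz.
    by have [] := chk _ _ u32 nz2 (zrowN (mem_head v2 t) nz).
  by have [] := chk _ _ u31 nz1 (zrowN yt nz).
have [y yt nzy] := zrowPn nz3.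
have nz3c v : ~~ zrow (map (b v3) (v :: t)) by apply: (zrowN (y := y)) => //; rewrite inE yt orbT.
(* The row of [v3] towards [t] occurs among the partners of both [v1] and [v2], which the table
   excludes. *)
move: (chk2 nz2) => /=; rewrite (introT (eqrowP _ _) erefl).
move=> /allP/(_ _ (in_ext2 _ _ u31 nz1 (nz3c v1))) /=; rewrite mem_rowE => /negP; apply.
by apply/mapP; exists (map (b v3) (v2 :: t)) => //; exact: in_ext2.
Qed.

End Extension.

(** * Exclusion of the forbidden quivers *)

Definition check_words (c : code) (ws : seq (seq nat)) : bool :=
  all (fun w => [&& all (fun i => i < size c)%N w, size (cmuts c w) == size c
    & eqcode (cmuts (cmuts c w) (rev w)) c]) ws.

Lemma check_e6_words : check_words e6 e6_words.
Proof. by vm_cast_no_check (erefl true). Qed.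
Lemma check_x6_words : check_words x6 x6_words.
Proof. by vm_cast_no_check (erefl true). Qed.
(** The walks chosen for extensions of E8 also serve these smaller quivers, since directions out of
    range are skipped. *)
Lemma check_mmi : all (fun c => (size c <= 10)%N && has (walk c) pool8) mmi.
Proof. by vm_cast_no_check (erefl true). Qed.

Section Exclusion.
Variable T : finType.
Implicit Types (b : T -> T -> Z) (t : seq T).
Hypothesis T10 : (10 < #|T|)%N.

Lemma no_e8 b t : extensible b t -> uniq t -> code_of b t <> e8.
Proof.
move=> ext ut e; have st : size t = 8 by rewrite -(size_code b) e.
by have [|u] := stage check_e8 T10 e ut _ ext; first by rewrite st.
Qed.

Lemma no_e7 b t : extensible b t -> uniq t -> code_of b t <> e7.
Proof.
move=> ext ut e; have st : size t = 7 by rewrite -(size_code b) e.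
have [|u _ [b' [t' [ext' ut' _ e']]]] := stage check_e7 T10 e ut _ ext; first by rewrite st.
exact: no_e8 ext' ut' e'.
Qed.

Lemma no_e6 b t : extensible b t -> uniq t -> code_of b t <> e6.
Proof.
move=> ext ut e; have st : size t = 6 by rewrite -(size_code b) e.
have [|u _ [b' [t' [ext' ut' _ e']]]] := stage check_e6 T10 e ut _ ext; first by rewrite st.
exact: no_e7 ext' ut' e'.
Qed.

Lemma no_x6 b t : extensible b t -> uniq t -> code_of b t <> x6.
Proof.
move=> ext ut e; have st : size t = 6 by rewrite -(size_code b) e.
by have [|u] := stage check_x6 T10 e ut _ ext; first by rewrite st.
Qed.

(** Mutating along the reversed word stays inside [t], hence preserves [extensible], and would
    produce [c]. *)
Lemma no_word c ws b t w : (forall b' t', extensible b' t' -> uniq t' -> code_of b' t' <> c) ->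
  check_words c ws -> w \in ws -> extensible b t -> uniq t -> code_of b t <> cmuts c w.
Proof.
move=> noc /allP chk /chk /and3P[wc /eqP sc /eqcodeP back] ext ut e.
have [sb _ _] := ext.
have st : size t = size c by rewrite -(size_code b) e.
case: t => [|x t] in ext ut e st *.
  by apply: (noc b [::]) => //; move: e st; case: (c) => [|r d] //.
have wt : all (fun i => i < size (x :: t))%N (rev w) by rewrite st all_rev.
apply: (noc (foldl (@mutf T) b (map (nth x (x :: t)) (rev w))) (x :: t)) => //.
  apply: extensible_foldl ext => y /mapP[i /(allP wt) it ->]; exact: mem_nth.
by rewrite -cmuts_code // e.
Qed.

Lemma no_rep b t : extensible b t -> uniq t -> code_of b t \notin reps.
Proof.
move=> ext ut; have [sb _ fb] := ext.
apply/negP; rewrite /reps mem_cat => /orP[m|].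
  have /andP[] := allP check_mmi _ m; rewrite size_code => st /hasP[w _ wk].
  by apply: (walk_unbounded sb ut (fun _ => id) wk); exact: fb.
rewrite mem_cat => /orP[] /mapP[w ww].
- exact: no_word no_e6 check_e6_words ww ext ut.
- exact: no_word no_x6 check_x6_words ww ext ut.
Qed.

Lemma tame_of_bounded b : skewsym b -> connected b ->
  (forall s, uniq s -> (size s <= 10)%N -> bounded_on b s) -> tame b.
Proof.
move=> sb cb fb; split=> [i j k u|t ut].
  by apply: (bounded_ok3 (t := [:: i; j; k])) => //; exact: fb.
by apply: no_rep => //; split=> // s us ss _; exact: fb.
Qed.

End Exclusion.

(** * Integer matrices *)

Import Order.TTheory GRing.Theory Num.Theory.

Section Bridge.
Variable n : nat.
Implicit Types (B C : 'M[int]_n) (S : {set 'I_n}).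

Definition entry B : 'I_n -> 'I_n -> Z := fun i j => Z_of_int (B i j).

Lemma skewsym_entry B : is_quiver B -> skewsym (entry B).
Proof.
by move=> /matrixP qB i j; have := qB i j; rewrite !mxE /entry => ->; rewrite raddfN.
Qed.

Lemma entry_mutation B k i j : skewsym (entry B) ->
  entry (mutation B k) i j = mutf (entry B) k i j.
Proof.
move=> sb; rewrite /entry mxE /mutf.
have [ik|ik] := boolP (i == k); first by rewrite raddfN.
have [jk|jk] := boolP (j == k); first by rewrite raddfN /=; case: (Z_of_int (B i k)).
have -> : Z_of_int (B j k) = Z.opp (Z_of_int (B k j)) by exact: (sb k j).
set a := Z_of_int (B i k); set c := Z_of_int (B k j).
(* [w] is the increment made by [step]; the numerator is twice [w], so the division is exact. *)
pose w := int_of_Z (Z.sub (step (entry B i j) (Some a) (Some (Z.opp c))) (entry B i j)).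
have -> : (`|B i k| * B k j + B i k * `|B k j|)%R = (w * 2)%R.
  apply: (can_inj Z_of_intK).
  have -> : Z_of_int (w * 2)%R = Z.mul 2 (Z_of_int w) by lia.
  have -> : Z_of_int (`|B i k| * B k j + B i k * `|B k j|)%R = Z.add (Z.abs a * c) (a * Z.abs c).
    by rewrite /a /c; lia.
  rewrite int_of_ZK /entry; clear w.
  by case: a => [|p|p]; case: c => [|q|q]; cbv [step Z.opp Z.abs]; lia.
rewrite mulzK //.
have := int_of_ZK (Z.sub (step (entry B i j) (Some a) (Some (Z.opp c))) (entry B i j)).
rewrite -/w /entry; move: (step _ _ _) => st /=; lia.
Qed.

Lemma entry_foldl B ks i j : skewsym (entry B) ->
  entry (foldl (@mutation n) B ks) i j = foldl (@mutf 'I_n) (entry B) ks i j.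
Proof.
(* The equality is only pointwise, so the last mutation is peeled off: [mutf] then needs just a few
   entries of the earlier result. *)
move=> sb; elim/last_ind: ks i j => // ks k IH i j; rewrite !foldl_rcons entry_mutation.
  by rewrite /mutf !IH.
by move=> p q; rewrite !IH; exact: skew_foldl.
Qed.

Lemma mutation_finite_bound B : mutation_finite B ->
  exists M, forall ks i j, (Z.abs (entry (foldl (@mutation n) B ks) i j) <= M)%Zd.
Proof.
move=> [cls fin].
exists (Z.of_nat (\sum_(C <- cls) \sum_(p : 'I_n * 'I_n) absz (C p.1 p.2))%N) => ks i j.
have Ccls := fin _ (ex_intro _ ks erefl); set C := foldl _ _ _ in Ccls *.
set S := (\sum_(_ <- _) _)%N.
have : (absz (C i j) <= S)%N.
  rewrite /S (big_rem C Ccls) /= (bigD1 (i, j)) //= -addnA; exact: leq_addr.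
by rewrite /entry; lia.
Qed.

Lemma foldl_subquiver B S ks :
  foldl (@mutation _) (subquiver B S) ks = subquiver (foldl (@mutation n) B (map enum_val ks)) S.
Proof.
elim: ks B => //= k ks IH B; rewrite -IH; congr foldl.
by apply/matrixP => i j; rewrite !mxE !(inj_eq enum_val_inj).
Qed.

End Bridge.

(** * Finite classes, bounded weights and connectedness *)

Section Main.
Variable n : nat.
Implicit Types (B C : 'M[int]_n) (s : seq 'I_n).

Lemma bounded_on_subquiver B s : is_quiver B ->
  mutation_finite (subquiver B [set x in s]) -> bounded_on (entry B) s.
Proof.
set S := [set x in s] => qB /mutation_finite_bound[M bM].
exists M => ks i j kss it jt.
have iS : i \in S by rewrite inE.
have jS : j \in S by rewrite inE.
rewrite -entry_foldl; last exact: skewsym_entry.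
have -> : ks = map enum_val (map (enum_rank_in iS) ks).
  rewrite -map_comp -[LHS]map_id; apply/eq_in_map => k kks /=.
  by rewrite enum_rankK_in // inE; exact: kss.
have := bM (map (enum_rank_in iS) ks) (enum_rank_in iS i) (enum_rank_in iS j).
by rewrite foldl_subquiver /entry mxE !enum_rankK_in.
Qed.

Lemma mutation_finite_of_bounded B M :
  (forall ks i j, (Z.abs (entry (foldl (@mutation n) B ks) i j) <= M)%Zd) -> mutation_finite B.
Proof.
move=> bM; set N := Z.to_nat M.
(* All matrices with entries between [-N] and [N], each entry shifted by [N] into an ordinal. *)
exists [seq (\matrix_(i, j) ((val (f (i, j)))%:Z - N%:Z))%R |
  f : {ffun 'I_n * 'I_n -> 'I_(2 * N).+1}].
move=> C [ks ->]; set D := foldl _ _ _.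
have bD i j : (absz (D i j + N%:Z)%R < (2 * N).+1)%N /\ (0 <= D i j + N%:Z)%R.
  by have := bM ks i j; rewrite -/D /entry /N; lia.
apply/imageP; exists [ffun p => inord (absz (D p.1 p.2 + N%:Z)%R)] => //.
apply/matrixP => i j; rewrite mxE ffunE /= inordK; last exact: (bD i j).1.
by rewrite gez0_abs ?(bD i j).2 // addrK.
Qed.

(** With no edge across the cut, a mutation on one side neither creates such an edge nor changes an
    entry on the other side. *)
Lemma foldl_separated (b : 'I_n -> 'I_n -> Z) (P : pred 'I_n) ks : skewsym b ->
  (forall x y, P x -> ~~ P y -> b x y = 0%Zd) ->
  (forall x y, P x -> ~~ P y -> foldl (@mutf _) b ks x y = 0%Zd) /\
  (forall x y, P x -> P y -> foldl (@mutf _) b ks x y = foldl (@mutf _) b (filter P ks) x y).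
Proof.
move=> sb sep; elim/last_ind: ks => // ks k [IH1 IH2].
have sk := skew_foldl ks sb.
rewrite filter_rcons !foldl_rcons; split=> x y Px Py.
  have exy := IH1 x y Px Py; rewrite /mutf exy; have [Pk|Pk] := boolP (P k).
    have -> : foldl (@mutf _) b ks y k = 0%Zd by rewrite sk IH1.
    by case: (x == k); case: (y == k); case: (foldl (@mutf _) b ks x k).
  by rewrite (IH1 x k Px Pk); case: (x == k); case: (y == k); case: (foldl (@mutf _) b ks y k).
have [Pk|Pk] := boolP (P k).
  by rewrite foldl_rcons /mutf !IH2.
have xk : x != k by apply: contraNneq Pk => <-.
have yk : y != k by apply: contraNneq Pk => <-.
by rewrite mutf_nonadjacent //; [exact: IH2 | left; exact: IH1].
Qed.

(** A cut without edges splits the quiver into two proper subquivers, finite by minimality, whose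
    bounds together bound the whole. *)
Lemma minimal_connected B : is_quiver B -> minimal_mutation_infinite B -> connected (entry B).
Proof.
move=> qB [inf fin] s x y xs ys; have sb := skewsym_entry qB.
have [/existsP[p /existsP[q /and3P[ps qs nz]]]|no] :=
  boolP [exists p, exists q, [&& p \in s, q \notin s & negb (Z.eqb (entry B p q) 0)]].
  by exists p, q; split=> //; lia.
have sep u v : u \in s -> v \notin s -> entry B u v = 0%Zd.
  move=> us vs; apply/Z.eqb_spec/negPn; move/existsPn/(_ u)/existsPn/(_ v): no.
  by rewrite us vs.
have sep' u v : u \notin s -> ~~ (v \notin s) -> entry B u v = 0%Zd.
  by move=> us /negPn vs; rewrite (sb v u) sep.
have sub (t : seq 'I_n) z : z \notin t -> bounded_on (entry B) t.
  move=> zt; apply: bounded_on_subquiver => //; apply: fin.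
  by rewrite properE subsetT /=; apply/subsetPn; exists z; rewrite ?inE.
have [M1 bM1] := sub s y ys.
have [M2 bM2] := sub [seq v <- enum 'I_n | v \notin s] x ltac:(by rewrite mem_filter xs).
case: inf; apply: (@mutation_finite_of_bounded B (Z.abs M1 + Z.abs M2)) => ks i j.
rewrite entry_foldl //.
have [z1 e1] := @foldl_separated _ (mem s) ks sb sep.
have [z2 e2] := @foldl_separated _ (fun v => v \notin s) ks sb sep'.
have in2 v : v \notin s -> v \in [seq v <- enum 'I_n | v \notin s].
  by rewrite mem_filter mem_enum andbT.
have sub1 : {subset filter (mem s) ks <= s} by move=> v; rewrite mem_filter => /andP[].
have sub2 : {subset [seq v <- ks | v \notin s] <= [seq v <- enum 'I_n | v \notin s]}.
  by move=> v; rewrite mem_filter => /andP[/in2].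
have [is_|is_] := boolP (i \in s); have [js|js] := boolP (j \in s).
- by rewrite (e1 i j is_ js); apply: Z.le_trans (bM1 _ i j sub1 is_ js) _; lia.
- by rewrite (z1 i j is_ js); lia.
- by rewrite (z2 i j is_ (introT negPn js)); lia.
- by rewrite (e2 i j is_ js); apply: Z.le_trans (bM2 _ i j sub2 (in2 _ is_) (in2 _ js)) _; lia.
Qed.

End Main.

Theorem lemma7p3 (n : nat) (B : 'M[int]_n) (quiverB : is_quiver B)
    (minB : minimal_mutation_infinite B) :
  (n <= 10)%N.
Proof.
have sb := skewsym_entry quiverB; have cb := minimal_connected quiverB minB.
have [inf fin] := minB; rewrite leqNgt; apply/negP => n10; case: inf.
have T10 : (10 < #|'I_n|)%N by rewrite card_ord.
have bs s : uniq s -> (size s <= 10)%N -> bounded_on (entry B) s.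
  (* At most 10 of more than 10 vertices form a proper subquiver, finite by minimality. *)
  move=> us ss; apply: bounded_on_subquiver => //; apply: fin.
  rewrite properEcard subsetT cardsE (card_uniqP us) cardsT.
  exact: leq_ltn_trans ss T10.
have [M bM] := tame_bounded (enum 'I_n) sb (tame_of_bounded T10 sb cb bs).
apply: (@mutation_finite_of_bounded _ B M) => ks i j.
by rewrite entry_foldl //; apply: bM => [k _||]; rewrite mem_enum.
Qed.
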